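(* Let $D$ be a division ring with multiplicative group $D^*$. Then every non-central almost subnormal subgroup of $D^*$ contains a non-central subnormal subgroup of $D^*$.
   Context: A subgroup $N$ of a group $G$ is subnormal in $G$ if there is a finite chain of subgroups $N=N_r\le N_{r-1}\le\dots\le N_1\le N_0=G$ with $N_{i+1}$ normal in $N_i$ for every $0\le i<r$. A subgroup $N$ of $G$ is almost subnormal in $G$ if there is a finite chain of subgroups $N=N_r\le N_{r-1}\le\dots\le N_1\le N_0=G$ such that for every $0\le i<r$, either $N_{i+1}$ is normal in $N_i$ or the index $[N_i:N_{i+1}]$ is finite. A subgroup of $D^*$ is central if it is contained in the center of $D$, and non-central otherwise. *)

(* Defs.v *)
From HB Require Import structures.
From mathcomp Require Import all_boot all_algebra.
From mathcomp Require Import boolp classical_sets functions cardinality.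

Set Implicit Arguments.
Unset Strict Implicit.
Unset Printing Implicit Defensive.

Local Open Scope classical_set_scope.

(* MathComp has no structure of division rings.  A [unitRingType] is nontrivial
   and not assumed commutative. *)
Definition division_ring (D : unitRingType) : Prop :=
  forall x : D, (x != 0)%R -> x \is a GRing.unit.

(* The multiplicative group of the units of a ring; for a division ring [D], this
   is D^* = D \ {0}.  The library's [{unit R}] is restricted to finite rings. *)
Record unit_group (R : unitRingType) : Type :=
  UnitGroup { unit_val : R; unit_valP : unit_val \is a GRing.unit }.

HB.instance Definition _ (R : unitRingType) :=
  [isSub of unit_group R for @unit_val R].
HB.instance Definition _ (R : unitRingType) :=
  [Choice of unit_group R by <:].

Section UnitGroup.
Variable R : unitRingType.
Implicit Types x y z : unit_group R.
Local Open Scope ring_scope.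

Definition ug_one : unit_group R := UnitGroup (GRing.unitr1 R).

Definition ug_inv x : unit_group R :=
  @UnitGroup R (val x)^-1 (etrans (GRing.unitrV (val x)) (unit_valP x)).

Fact ug_mul_subproof x y : val x * val y \is a GRing.unit.
Proof. by rewrite GRing.unitrMl unit_valP. Qed.

Definition ug_mul x y : unit_group R := UnitGroup (ug_mul_subproof x y).

Fact ug_mulA : associative ug_mul.
Proof. by move=> x y z; apply: val_inj; rewrite /= GRing.mulrA. Qed.

Fact ug_mul1 : left_id ug_one ug_mul.
Proof. by move=> x; apply: val_inj; rewrite /= GRing.mul1r. Qed.

Fact ug_mulr1 : right_id ug_one ug_mul.
Proof. by move=> x; apply: val_inj; rewrite /= GRing.mulr1. Qed.

Fact ug_mulV : left_inverse ug_one ug_inv ug_mul.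
Proof. by move=> x; apply: val_inj; rewrite /= GRing.mulVr ?unit_valP. Qed.

Fact ug_mulrV : right_inverse ug_one ug_inv ug_mul.
Proof. by move=> x; apply: val_inj; rewrite /= GRing.mulrV ?unit_valP. Qed.

HB.instance Definition _ := isGroup.Build (unit_group R)
  ug_mulA ug_mul1 ug_mulr1 ug_mulV ug_mulrV.

End UnitGroup.

(* Subgroups of possibly infinite groups are represented as sets: the library's
   [{group gT}] requires [gT] to be finite. *)
Section Subgroups.
Variable G : groupType.
Implicit Types H K N : set G.
Local Open Scope group_scope.

Definition is_subgroup H : Prop :=
  [/\ H 1, forall x y, H x -> H y -> H (x * y) & forall x, H x -> H x^-1].

(* In the next two definitions, [K] and [H] are meant to be subgroups with
   [K `<=` H]; [subnormal] and [almost_subnormal] impose it. *)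
Definition normal_in K H : Prop :=
  forall x h, K x -> H h -> K (x ^ h).

Definition left_coset K (x : G) : set G := [set x * k | k in K].

Definition finite_index K H : Prop :=
  finite_set [set left_coset K x | x in H].

(* [step K H] is the condition on each inclusion K <= H of the chain. *)
Definition subgroup_chain (step : set G -> set G -> Prop) N : Prop :=
  exists (r : nat) (C : nat -> set G),
    [/\ C 0%N = setT, C r = N,
        forall i, (i <= r)%N -> is_subgroup (C i) &
        forall i, (i < r)%N -> C i.+1 `<=` C i /\ step (C i.+1) (C i)].

Definition subnormal N : Prop := subgroup_chain normal_in N.

Definition almost_subnormal N : Prop :=
  subgroup_chain (fun K H => normal_in K H \/ finite_index K H) N.

End Subgroups.

Definition ring_center (R : pzRingType) : set R :=
  [set z | forall y : R, GRing.comm z y].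

Definition central (R : unitRingType) (N : set (unit_group R)) : Prop :=
  [set val x | x in N] `<=` @ring_center R.

(* Main.v *)
Require Import Defs.
From HB Require Import structures.
From mathcomp Require Import all_boot all_algebra finfield.
From mathcomp Require Import boolp classical_sets functions cardinality filter.
From Stdlib Require Ncring Ncring_tac.
Import -(notations) Ncring Ncring_tac.

(** Write [Z] for the center of [D].  Given a chain [N_r <= .. <= N_0 = D^*]
    witnessing almost subnormality, one builds subgroups [M_i] of [N_i], each
    normal in the previous one: [M_(i+1)] is [M_i :&: N_(i+1)] when [N_(i+1)] is
    normal in [N_i], and the largest normal subgroup of [M_i] contained in
    [N_(i+1)] when the index is finite.  What has to be shown is that
    noncentrality passes from the [N_i] to the [M_i] (Lemmas [chain_step_normal]
    and [chain_step_finite_index]).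

    Everything rests on Lemma [centralizer_subnormal]: the centralizer of a
    noncentral subnormal subgroup [M] is contained in [Z].  It implies that [x]
    is central as soon as all the commutators [[x, m_1, .., m_n]], with the [m_i]
    in [M], are central ([subnormal_central_commutators]); hence, for a
    noncentral element [x] of [N], some such commutator is noncentral, and for a
    suitable [n] it lies in [M_i :&: N_(i+1)].  It also implies that [M] is not
    finite modulo [Z] ([subnormal_not_finite_mod_center]): otherwise, climbing up
    the chain, [D^*] would be.

    The proof of [centralizer_subnormal] is an induction on the length of the
    chain.  Let [K] be a subnormal subgroup of depth [n] whose centralizer is
    central.  For every nonzero [e] and all [k_i] in [K], the commutator
    [[e, k_1, .., k_n]] lies in [K], so that it normalizes every division subring
    normalized by [K].  Take [e = 1 + a tau] and [k_i = h], where [tau] behaves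
    like an indeterminate over a division subring containing [a] and [h].  The
    commutator is a product of factors [(1 + c tau)^(+-1)], and Lemma
    [first_order_const], a computation with left fractions of skew polynomials,
    says that such a product can only be constant if the sum of the [+- c]
    vanishes.  For iterated commutators with [h] this sum is given by the
    iterates of [delta h : w |-> w - h w h^-1], so that multiplicative identities
    become linear ones.  Two kinds of indeterminates occur: a variable running
    through infinitely many commuting elements ([infinite_commuting_coef]), and
    an element whose powers are left independent ([skew_commutator_coef]).  When
    [Z] is infinite its elements provide the former; when it is finite,
    Wedderburn's theorem and Jacobson's theorem on torsion division rings
    provide one or the other.

    The consequences are, in this order: an element whose commutators with [K]
    are central is central ([central_commutators]), hence a noncentral division
    subring normalized by [K] meets [K] in a noncentral element
    ([normalized_noncentral]); a commutative division subring normalized by [K]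
    is central ([commutative_normalized_central]); if [L] is the centralizer of a
    noncentral normal subgroup of [K], the elements of [L :&: K] act unipotently
    on [L] by conjugation ([centralizer_unipotent]).  If [L] were noncentral, it
    would therefore contain [y] and some [k] in [K] with [k y k^-1 = y - 1].  This
    contradicts unipotence: in characteristic zero an iterate of [delta k] maps a
    power of [y] to a nonzero integer, and in positive characteristic the
    commutator [u = [y, k, .., k]] commutes with [[u, k]], which is not 1. *)

Set Implicit Arguments.
Unset Strict Implicit.
Unset Printing Implicit Defensive.

Import GRing.Theory.
Local Open Scope classical_set_scope.
Local Open Scope ring_scope.

(** * Arithmetic in a division ring *)

(** Instances for the normalization of noncommutative ring expressions. *)
Section NcringInstance.
Variable D : unitRingType.
Local Definition subtraction (x y : D) : D := x - y.

#[local] Instance unit_ring_ops :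
  @Ring_ops D 0%R 1%R +%R *%R subtraction (@GRing.opp D) eq := {}.
#[local] Instance unit_ring_ncring : @Ring _ _ _ _ _ _ _ _ unit_ring_ops.
Proof.
split; first exact: RelationClasses.eq_equivalence.
- by move=> x y -> z t ->.
- by move=> x y -> z t ->.
- by move=> x y -> z t ->.
- by move=> x y ->.
- exact: add0r.
- exact: addrC.
- exact: addrA.
- exact: mul1r.
- exact: mulr1.
- exact: mulrA.
- exact: mulrDl.
- by move=> x y z; exact: mulrDr.
- by [].
- exact: subrr.
Qed.
End NcringInstance.
#[local] Existing Instance unit_ring_ops.
#[local] Existing Instance unit_ring_ncring.

Section DivisionRing.
Variable D : unitRingType.
Hypothesis hD : division_ring D.
Implicit Types (x y z : D) (E : set D).

Lemma div_mulVr x : x != 0 -> x^-1 * x = 1.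
Proof. by move=> /hD ux; rewrite mulVr. Qed.

Lemma div_mulrV x : x != 0 -> x * x^-1 = 1.
Proof. by move=> /hD ux; rewrite mulrV. Qed.

Lemma div_mulrK x y : x != 0 -> y * x * x^-1 = y.
Proof. by move=> /hD ux; rewrite mulrK. Qed.

Lemma div_mulrVK x y : x != 0 -> y * x^-1 * x = y.
Proof. by move=> /hD ux; rewrite mulrVK. Qed.

Lemma div_mulKr x y : x != 0 -> x^-1 * (x * y) = y.
Proof. by move=> /hD ux; rewrite mulKr. Qed.

Lemma div_mulVKr x y : x != 0 -> x * (x^-1 * y) = y.
Proof. by move=> /hD ux; rewrite mulVKr. Qed.

Lemma div_mulIr x y z : x != 0 -> y * x = z * x -> y = z.
Proof. by move=> /hD/mulIr; exact. Qed.

Lemma div_mulrI x y z : x != 0 -> x * y = x * z -> y = z.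
Proof. by move=> /hD/mulrI; exact. Qed.

Lemma div_mulf_eq0 x y : x * y = 0 -> x != 0 -> y = 0.
Proof. by move=> xy0 x0; apply: (div_mulrI x0); rewrite mulr0. Qed.

Lemma div_mulf_neq0 x y : x != 0 -> y != 0 -> x * y != 0.
Proof. by move=> x0; apply: contra_neq => /div_mulf_eq0; exact. Qed.

Lemma div_expf_neq0 x n : x != 0 -> x ^+ n != 0.
Proof.
by move=> x0; elim: n => [|n IH]; rewrite ?expr0 ?oner_neq0 // exprS div_mulf_neq0.
Qed.

Lemma div_invMr x y : x != 0 -> y != 0 -> (x * y)^-1 = y^-1 * x^-1.
Proof. by move=> /hD ? /hD ?; rewrite invrM. Qed.

(** [E] is a division subring; the inverse of 0 is 0, so that closure under
    inversion needs no side condition. *)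
Definition div_subring E :=
  [/\ E 1, forall x y, E x -> E y -> E (x - y),
      forall x y, E x -> E y -> E (x * y) & forall x, E x -> E x^-1].

Section DivSubring.
Variable E : set D.
Hypothesis sE : div_subring E.

Lemma subring1 : E 1. Proof. by case: sE. Qed.
Lemma subringB x y : E x -> E y -> E (x - y). Proof. by case: sE => ? H ? ?; apply: H. Qed.
Lemma subringM x y : E x -> E y -> E (x * y). Proof. by case: sE => ? ? H ?; apply: H. Qed.
Lemma subringV x : E x -> E x^-1. Proof. by case: sE => ? ? ? H; apply: H. Qed.
Lemma subring0 : E 0. Proof. by rewrite -(subrr 1); apply: subringB; exact: subring1. Qed.
Lemma subringN x : E x -> E (- x).
Proof. by move=> Ex; rewrite -sub0r; apply: subringB => //; exact: subring0. Qed.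
Lemma subringD x y : E x -> E y -> E (x + y).
Proof. by move=> Ex Ey; rewrite -(opprK y); apply: subringB => //; exact: subringN. Qed.
Lemma subringX x n : E x -> E (x ^+ n).
Proof.
move=> Ex; elim: n => [|n IH]; rewrite ?expr0 ?exprS; first exact: subring1.
exact: subringM.
Qed.

End DivSubring.

Lemma commr_inv x y : GRing.comm x y -> GRing.comm x^-1 y.
Proof. by move=> /commr_sym/commrV/commr_sym. Qed.

(** The group commutator [[x, h]], with [h] as first argument for iteration. *)
Definition gcommut h x : D := x * h * x^-1 * h^-1.

(** The linear counterpart of [gcommut]: identity minus conjugation by [h]. *)
Definition delta h w : D := w - h * w * h^-1.

(** * First-order coefficients of products of linear factors *)

(** The setting covers both kinds of indeterminates: [tau] is a family of elements
    of [D], identities between families hold almost everywhere for the filter [F],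
    and [tau e = sg e tau] for [e] in the division subring [E], on which [sg]
    is onto. *)
Section FirstOrder.
Variables (I : Type) (F : set_system I) (FF : Filter F).
Variables (E : set D) (tau : I -> D) (sg : D -> D).
Hypothesis sE : div_subring E.
Hypothesis sgE : forall e, E e -> E (sg e).
Hypothesis sgS : forall e, E e -> exists2 e', E e' & sg e' = e.
Hypothesis tauM : forall i e, E e -> tau i * e = sg e * tau i.
Hypothesis tau0 : \forall i \near F, tau i != 0.
Hypothesis tau1 : forall c, E c -> \forall i \near F, 1 + c * tau i != 0.

(** [f] is almost everywhere a polynomial in [tau] of degree less than [n], with
    coefficients in [E] on the left. *)
Fixpoint skew_poly n (f : I -> D) : Prop :=
  if n is m.+1 then
    exists a g, [/\ E a, skew_poly m g & \forall i \near F, f i = a + g i * tau i]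
  else \forall i \near F, f i = 0.

(** [tau] is an indeterminate: the constant term of a polynomial that vanishes
    almost everywhere is zero. *)
Hypothesis indep : forall n a f, E a -> skew_poly n f ->
  (\forall i \near F, a + f i * tau i = 0) -> a = 0.

Lemma skew_poly_eq n f g : (\forall i \near F, f i = g i) ->
  skew_poly n f -> skew_poly n g.
Proof.
case: n => [|n] fg /= => [f0|[a [h [Ea Ph fah]]]].
  by apply: filterS2 fg f0 => i <-.
by exists a, h; split=> //; apply: filterS2 fg fah => i <-.
Qed.

Lemma skew_poly0 n : skew_poly n (fun=> 0).
Proof.
elim: n => [|n IH] /=; first exact: nearW.
exists 0, (fun=> 0); split=> //; first exact: subring0.
by apply: nearW => i; rewrite mul0r addr0.
Qed.

Lemma skew_polyS n f : skew_poly n f -> skew_poly n.+1 f.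
Proof.
elim: n f => [|n IH] f.
  move=> /= f0; exists 0, (fun=> 0); split=> //; [exact: subring0|exact: nearW|].
  by apply: filterS f0 => i ->; rewrite mul0r addr0.
by move=> [a [g [Ea Pg fE]]]; exists a, g; split=> //; exact: IH.
Qed.

Lemma skew_polyD n f g : skew_poly n f -> skew_poly n g ->
  skew_poly n (fun i => f i + g i).
Proof.
elim: n f g => [|n IH] f g /=.
  by apply: filterS2 => i -> ->; rewrite addr0.
move=> [a [f' [Ea Pf fE]]] [b [g' [Eb Pg gE]]].
exists (a + b), (fun i => f' i + g' i); split; [exact: subringD|exact: IH|].
by apply: filterS2 fE gE => i -> ->; non_commutative_ring.
Qed.

Lemma skew_polyZ n a f : E a -> skew_poly n f -> skew_poly n (fun i => a * f i).
Proof.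
move=> Ea; elim: n f => [|n IH] f /=.
  by apply: filterS => i ->; rewrite mulr0.
move=> [b [g [Eb Pg fE]]].
exists (a * b), (fun i => a * g i); split; [exact: subringM|exact: IH|].
by apply: filterS fE => i ->; non_commutative_ring.
Qed.

Lemma skew_polyZr n a f : E a -> skew_poly n f -> skew_poly n (fun i => f i * a).
Proof.
elim: n a f => [|n IH] a f Ea /=.
  by apply: filterS => i ->; rewrite mul0r.
move=> [b [g [Eb Pg fE]]].
exists (b * a), (fun i => g i * sg a); split; [exact: subringM|apply: IH => //; exact: sgE|].
by apply: filterS fE => i ->; rewrite mulrDl -!mulrA tauM.
Qed.

Lemma skew_polyC n a : E a -> skew_poly n.+1 (fun=> a).
Proof.
move=> Ea; exists a, (fun=> 0); split=> //; first exact: skew_poly0.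
by apply: nearW => i; rewrite mul0r addr0.
Qed.

Lemma skew_polyMtau n f : skew_poly n f -> skew_poly n.+1 (fun i => f i * tau i).
Proof.
move=> Pf; exists 0, f; split=> //; first exact: subring0.
by apply: nearW => i; rewrite add0r.
Qed.

(** Conjugation by [tau^-1] applies the inverse of [sg] to the coefficients. *)
Lemma skew_poly_conj n f : skew_poly n f ->
  exists2 g, skew_poly n g & \forall i \near F, f i * tau i = tau i * g i.
Proof.
elim: n f => [|n IH] f /= => [f0|[a [h [/sgS[a' Ea' <-] Ph fE]]]].
  exists (fun=> 0); first exact: nearW.
  by apply: filterS f0 => i ->; rewrite mul0r mulr0.
have [h' Ph' hE] := IH _ Ph.
exists (fun i => a' + h' i * tau i).
  by exists a', h'; split=> //; exact: nearW.
apply: filterS2 fE hE => i -> hE.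
by rewrite mulrDl hE mulrDr (tauM i Ea'); non_commutative_ring.
Qed.

Lemma skew_poly_tau n f : skew_poly n f -> skew_poly n.+1 (fun i => tau i * f i).
Proof.
elim: n f => [|n IH] f => [f0|[a [g [Ea Pg fE]]]].
  apply: (skew_poly_eq _ (skew_poly0 1)).
  by apply: filterS f0 => i ->; rewrite mulr0.
exists 0, (fun i => sg a + tau i * g i); split; first exact: subring0.
  by apply: skew_polyD (IH _ Pg); apply: skew_polyC; exact: sgE.
by apply: filterS fE => i ->; rewrite mulrDr tauM //; non_commutative_ring.
Qed.

Definition is_skew_poly f := exists n, skew_poly n f.

Lemma skew_poly_le n m f : (n <= m)%N -> skew_poly n f -> skew_poly m f.
Proof. by move=> /subnK<-; elim: (m - n)%N => [//|k IH] /IH; exact: skew_polyS. Qed.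

Lemma is_skew_polyD f g : is_skew_poly f -> is_skew_poly g ->
  is_skew_poly (fun i => f i + g i).
Proof.
move=> [n Pf] [m Pg]; exists (maxn n m).
by apply: skew_polyD; [apply: skew_poly_le Pf|apply: skew_poly_le Pg];
  rewrite ?leq_maxl ?leq_maxr.
Qed.

Lemma skew_poly_uniq a b f g : E a -> E b -> is_skew_poly f -> is_skew_poly g ->
  (\forall i \near F, a + f i * tau i = b + g i * tau i) ->
  a = b /\ \forall i \near F, f i = g i.
Proof.
move=> Ea Eb Pf Pg fg.
have Pd : is_skew_poly (fun i => f i + (- 1) * g i).
  apply: is_skew_polyD => //; case: Pg => m Pg; exists m.
  by apply: skew_polyZ Pg; apply: subringN => //; exact: subring1.
have ab : a = b.
  apply/eqP; rewrite -subr_eq0; apply/eqP.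
  case: Pd => n Pd; apply: (indep _ Pd); first exact: subringB.
  apply: filterS fg => i e.
  have -> : a - b + (f i + -1 * g i) * tau i = a + f i * tau i - (b + g i * tau i).
    by non_commutative_ring.
  by rewrite e subrr.
split=> //; apply: filterS2 tau0 fg => i t0; rewrite ab => /addrI.
exact: div_mulIr.
Qed.

(** Right Euclidean division by [1 + c tau], the remainder being constant. *)
Lemma skew_poly_div n f c : E c -> c != 0 -> skew_poly n f ->
  exists r q, [/\ E r, is_skew_poly q &
    \forall i \near F, f i = q i * (1 + c * tau i) + r].
Proof.
move=> Ec c0; elim: n f => [|n IH] f => [f0|[a [g [Ea Pg fE]]]].
  exists 0, (fun=> 0); split; [exact: subring0|by exists 0%N; exact: nearW|].
  by apply: filterS f0 => i ->; rewrite mul0r addr0.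
have EcV : E c^-1 by exact: subringV.
have [r [q [Er Pq qE]]] := IH _ (skew_polyZr EcV Pg).
exists (a - r), (fun i => g i * c^-1 + (-1) * q i); split; first exact: subringB.
  apply: is_skew_polyD; first by exists n; exact: skew_polyZr.
  case: Pq => m Pq; exists m; apply: skew_polyZ Pq.
  by apply: subringN => //; exact: subring1.
apply: filterS2 fE qE => i -> qE.
have -> : (g i * c^-1 + -1 * q i) * (1 + c * tau i) + (a - r)
  = g i * (c^-1 * c) * tau i + a + (g i * c^-1 - (q i * (1 + c * tau i) + r)).
  by non_commutative_ring.
by rewrite -qE subrr addr0 div_mulVr // mulr1 addrC.
Qed.

Lemma is_skew_polyZ a f : E a -> is_skew_poly f -> is_skew_poly (fun i => a * f i).
Proof. by move=> Ea [n Pf]; exists n; exact: skew_polyZ. Qed.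

Lemma is_skew_polyZr a f : E a -> is_skew_poly f -> is_skew_poly (fun i => f i * a).
Proof. by move=> Ea [n Pf]; exists n; exact: skew_polyZr. Qed.

Lemma is_skew_polyC a : E a -> is_skew_poly (fun=> a).
Proof. by move=> Ea; exists 1%N; exact: skew_polyC. Qed.

Lemma is_skew_polyMtau f : is_skew_poly f -> is_skew_poly (fun i => f i * tau i).
Proof. by move=> [n Pf]; exists n.+1; exact: skew_polyMtau. Qed.

Lemma is_skew_poly_tau f : is_skew_poly f -> is_skew_poly (fun i => tau i * f i).
Proof. by move=> [n Pf]; exists n.+1; exact: skew_poly_tau. Qed.

(** The two lowest coefficients of an exact quotient by [1 + c tau]. *)
Lemma skew_poly_quotient_low a b c f p : E a -> E b -> E c ->
  is_skew_poly f -> is_skew_poly p ->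
  (\forall i \near F, f i * (1 + c * tau i) = a + (b + p i * tau i) * tau i) ->
  exists2 p', is_skew_poly p' &
    \forall i \near F, f i = a + (b - a * c + p' i * tau i) * tau i.
Proof.
move=> Ea Eb Ec [n /skew_polyS/skew_polyS[a' [f' [Ea' [b' [h [Eb' Ph f'E]]] fE]]]] Pp.
move=> fME; have Ph' : is_skew_poly h by exists n.
have Esc := sgE Ec; have Essc := sgE Esc.
have [aa' bE] : a' = a /\ \forall i \near F,
    a' * c + b' + (h i + b' * sg c + h i * sg (sg c) * tau i) * tau i = b + p i * tau i.
  apply: skew_poly_uniq => //.
  - apply: is_skew_polyD; first by apply: is_skew_polyC; apply: subringD => //; exact: subringM.
    apply: is_skew_polyMtau; apply: is_skew_polyD.
      by apply: is_skew_polyD => //; apply: is_skew_polyC; exact: subringM.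
    by apply: is_skew_polyMtau; exact: is_skew_polyZr.
  - by apply: is_skew_polyD; [exact: is_skew_polyC|exact: is_skew_polyMtau].
  apply: filterS3 fE f'E fME => i fE f'E <-; rewrite fE f'E.
  transitivity (a' + (a' * c + b') * tau i + b' * (tau i * c) * tau i
    + h i * tau i * tau i + h i * (tau i * (tau i * c)) * tau i); last by non_commutative_ring.
  by rewrite (tauM i Ec) [tau i * (sg c * _)]mulrA (tauM i Esc); non_commutative_ring.
have [bb' _] : a' * c + b' = b /\ \forall i \near F,
    h i + b' * sg c + h i * sg (sg c) * tau i = p i.
  apply: skew_poly_uniq => //.
  - by apply: subringD => //; exact: subringM.
  - apply: is_skew_polyD.
      by apply: is_skew_polyD => //; apply: is_skew_polyC; exact: subringM.
    by apply: is_skew_polyMtau; exact: is_skew_polyZr.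
exists h => //; apply: filterS2 fE f'E => i -> ->.
by rewrite -bb' aa'; non_commutative_ring.
Qed.

(** [g] is a product of factors [(1 + c tau)^(+-1)] with [c] in [E]; [w] is the
    corresponding sum of the [+- c], its coefficient of degree one in [tau]. *)
Inductive first_order : (I -> D) -> D -> Prop :=
| FirstOrder1 g : (\forall i \near F, g i = 1) -> first_order g 0
| FirstOrderM g w c h : first_order g w -> E c ->
    (\forall i \near F, h i = g i * (1 + c * tau i)) -> first_order h (w + c)
| FirstOrderV g w c h : first_order g w -> E c ->
    (\forall i \near F, h i = g i * (1 + c * tau i)^-1) -> first_order h (w - c).

Lemma first_order_coef g w : first_order g w -> E w.
Proof.
elim=> [*|*|*]; [exact: subring0|exact: subringD|exact: subringB].
Qed.

(** [g] is a left fraction [q^-1 p] of skew polynomials whose quotient expands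
    as [1 + w tau + ..]: the two lowest coefficients are [q0, q1] for [q] and
    [q0, q1 + q0 w] for [p], with [q0 <> 0]. *)
Definition left_fraction g w := exists q0 q1 q p,
  [/\ E q0 /\ q0 != 0, E q1, is_skew_poly q, is_skew_poly p &
   \forall i \near F, (q0 + (q1 + q i * tau i) * tau i) * g i
                    = q0 + (q1 + q0 * w + p i * tau i) * tau i].

(** The induction step for a factor [(1 + c tau)^-1] is an Ore condition: with
    [P] the current numerator, the remainders of [P] and [tau P] modulo
    [1 + c tau] are proportional, so that [P + r1 tau P] is a right multiple of
    [1 + c tau], unless [tau P], and then [P] itself, is one. *)
Lemma first_order_fraction g w : first_order g w -> left_fraction g w.
Proof.
elim=> {g w} [g g1|g w c h Fg IH Ec hE|g w c h Fg IH Ec hE].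
- exists 1, 0, (fun=> 0), (fun=> 0); split.
  + by split; [exact: subring1|exact: oner_neq0].
  + exact: subring0.
  + by exists 0%N; exact: skew_poly0.
  + by exists 0%N; exact: skew_poly0.
  by apply: filterS g1 => i ->; non_commutative_ring.
- have Ew := first_order_coef Fg.
  have [q0 [q1 [q [p [[Eq0 q00] Eq1 Pq Pp qE]]]]] := IH.
  exists q0, q1, q, (fun i => p i + ((q1 + q0 * w) * sg c + p i * sg (sg c) * tau i)).
  have Esc := sgE Ec; have Essc := sgE Esc.
  split=> //.
    have Eqw : E (q1 + q0 * w) by apply: subringD => //; exact: subringM.
    apply: is_skew_polyD => //; apply: is_skew_polyD.
      by exists 1%N; apply: skew_polyC; exact: subringM.
    case: Pp => n Pp; exists n.+1; apply: skew_polyMtau; exact: skew_polyZr.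
  apply: filterS2 hE qE => i -> qE; rewrite mulrA qE.
  transitivity (q0 + (q1 + q0 * (w + c) + p i * tau i) * tau i
    + (q1 + q0 * w) * (tau i * c) * tau i + p i * (tau i * (tau i * c)) * tau i).
    by non_commutative_ring.
  by rewrite tauM // [tau i * (sg c * _)]mulrA tauM //; non_commutative_ring.
have Ew := first_order_coef Fg.
have [q0 [q1 [q [p [[Eq0 q00] Eq1 Pq Pp qE]]]]] := IH.
have [c0|c0] := eqVneq c 0.
  exists q0, q1, q, p; split=> //; apply: filterS2 hE qE => i -> qE.
  by rewrite c0 subr0 mul0r addr0 invr1 mulr1.
have Eqw : E (q1 + q0 * w) by apply: subringD => //; exact: subringM.
pose P i := q0 + (q1 + q0 * w + p i * tau i) * tau i.
have [n PP] : is_skew_poly P.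
  case: Pp => m Pp; exists m.+2, q0, (fun i => q1 + q0 * w + p i * tau i).
  split=> //; last exact: nearW.
  by exists (q1 + q0 * w), p; split=> //; exact: nearW.
have [r [u [Er Pu uE]]] := skew_poly_div Ec c0 PP.
have [r' [u' [Er' Pu' uE']]] := skew_poly_div Ec c0 (skew_poly_tau PP).
have EB := sgE Eq0; have EC := sgE Eqw; have ED := sgE Eq1.
have [r'0|r'0] := eqVneq r' 0.
  (* tau P = u' (1 + c tau), and the factor tau can be cancelled on the left *)
  have Ptau : is_skew_poly (fun i => sg q0 + (sg (q1 + q0 * w) + tau i * p i) * tau i).
    apply: is_skew_polyD; first exact: is_skew_polyC.
    apply: is_skew_polyMtau; apply: is_skew_polyD; first exact: is_skew_polyC.
    exact: is_skew_poly_tau.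
  have uE'' : \forall i \near F, u' i * (1 + c * tau i)
      = 0 + (sg q0 + (sg (q1 + q0 * w) + tau i * p i) * tau i) * tau i.
    apply: filterS uE' => i; rewrite r'0 addr0 => <-.
    rewrite /P mulrDr (tauM i Eq0) [tau i * (_ * tau i)]mulrA mulrDr (tauM i Eqw).
    by non_commutative_ring.
  have [] := @skew_poly_quotient_low 0 (sg q0) c u'
    (fun i => sg (q1 + q0 * w) + tau i * p i) (subring0 sE) EB Ec Pu'.
  - by apply: is_skew_polyD; [exact: is_skew_polyC|exact: is_skew_poly_tau].
  - exact: uE''.
  move=> p' Pp' u'E.
  have Pv : is_skew_poly (fun i => sg q0 - 0 * c + p' i * tau i).
    apply: is_skew_polyD; last exact: is_skew_polyMtau.
    by apply: is_skew_polyC; rewrite mul0r subr0.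
  have [m Pvm] := Pv; have [v Pv' vE] := skew_poly_conj Pvm.
  have vM : \forall i \near F, v i * (1 + c * tau i) = P i.
    apply: filterS2 tau0 _ => [i t0 e|].
      by apply: (div_mulrI t0); exact: e.
    apply: filterS3 vE u'E uE' => i vE u'E; rewrite r'0 addr0 => ->.
    by rewrite u'E add0r vE mulrA.
  have [|p'' Pp'' vE'] := skew_poly_quotient_low Eq0 Eqw Ec _ Pp vM.
    by exists m.
  exists q0, q1, q, p''; split=> //.
  have := tau1 Ec => t1; apply: filterS3 hE qE (filterI t1 (filterI vM vE')).
  move=> i -> qE [{}t1 [vM' vE'']]; rewrite mulrA qE -/(P i) -vM' div_mulrK // vE''.
  by non_commutative_ring.
pose r1 := - (r * r'^-1).
have Er1 : E r1 by apply: subringN => //; apply: subringM => //; exact: subringV.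
have r1r : r1 * r' = - r by rewrite mulNr div_mulrVK.
pose u1 i := u i + r1 * u' i.
pose p1 i := p i + (r1 * sg (q1 + q0 * w) + r1 * (tau i * p i)).
pose q' i := q i + (r1 * sg q1 + r1 * (tau i * q i)).
have Pu1 : is_skew_poly u1 by apply: is_skew_polyD => //; exact: is_skew_polyZ.
have Pp1 : is_skew_poly p1.
  apply: is_skew_polyD => //; apply: is_skew_polyD.
    by apply: is_skew_polyC; exact: subringM.
  by apply: is_skew_polyZ => //; exact: is_skew_poly_tau.
have Pq' : is_skew_poly q'.
  apply: is_skew_polyD => //; apply: is_skew_polyD.
    by apply: is_skew_polyC; exact: subringM.
  by apply: is_skew_polyZ => //; exact: is_skew_poly_tau.
have uM : \forall i \near F, u1 i * (1 + c * tau i) = P i + r1 * (tau i * P i).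
  apply: filterS2 uE uE' => i -> ->.
  rewrite /u1 mulrDl; transitivity (u i * (1 + c * tau i) + r
    + r1 * (u' i * (1 + c * tau i)) - r); first by non_commutative_ring.
  by rewrite -r1r; non_commutative_ring.
have PE i : P i + r1 * (tau i * P i)
    = q0 + (q1 + q0 * w + r1 * sg q0 + p1 i * tau i) * tau i.
  transitivity (P i + r1 * (tau i * q0 + tau i * (q1 + q0 * w) * tau i
     + tau i * p i * tau i * tau i)); first by rewrite /P; non_commutative_ring.
  by rewrite (tauM i Eq0) (tauM i Eqw) /P /p1; non_commutative_ring.
have [||p'' Pp'' vE'] := @skew_poly_quotient_low q0 (q1 + q0 * w + r1 * sg q0) c u1 p1
  Eq0 _ Ec Pu1 Pp1.
- by apply: subringD => //; exact: subringM.
- by apply: filterS uM => i ->; exact: PE.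
exists q0, (q1 + r1 * sg q0), q', p''; split=> //.
  by apply: subringD => //; exact: subringM.
have t1 := tau1 Ec; apply: filterS3 hE qE (filterI t1 (filterI uM vE')).
move=> i -> qE [{}t1 [uM' vE'']].
have -> : q0 + (q1 + r1 * sg q0 + q' i * tau i) * tau i
  = q0 + (q1 + q i * tau i) * tau i + r1 * (tau i * (q0 + (q1 + q i * tau i) * tau i)).
  transitivity (q0 + (q1 + q i * tau i) * tau i +  r1 * (tau i * q0 + tau i * q1 * tau i
     + tau i * q i * tau i * tau i)); last by non_commutative_ring.
  by rewrite (tauM i Eq0) (tauM i Eq1) /q'; non_commutative_ring.
rewrite mulrA mulrDl -(mulrA r1) -(mulrA (tau i)) qE -/(P i) -uM' div_mulrK // vE''.
by non_commutative_ring.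
Qed.

(** Comparing the lowest coefficients of [q a = p] gives [a = 1] and then
    [q0 w = 0]. *)
Lemma first_order_const g w a : first_order g w -> E a ->
  (\forall i \near F, g i = a) -> w = 0.
Proof.
move=> Fg Ea ga; have Ew := first_order_coef Fg.
have [q0 [q1 [q [p [[Eq0 q00] Eq1 Pq Pp qE]]]]] := first_order_fraction Fg.
have Eqw : E (q1 + q0 * w) by apply: subringD => //; exact: subringM.
have Esa := sgE Ea; have Essa := sgE Esa.
have [a1 eq1] : q0 * a = q0 /\ \forall i \near F,
    q1 * sg a + (q i * sg (sg a)) * tau i = q1 + q0 * w + p i * tau i.
  apply: skew_poly_uniq => //.
  - exact: subringM.
  - apply: is_skew_polyD; first by apply: is_skew_polyC; exact: subringM.
    by apply: is_skew_polyMtau; exact: is_skew_polyZr.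
  - by apply: is_skew_polyD; [exact: is_skew_polyC|exact: is_skew_polyMtau].
  apply: filterS2 qE ga => i qE gi; rewrite -qE gi.
  transitivity (q0 * a + q1 * (tau i * a) + q i * (tau i * (tau i * a))); last by non_commutative_ring.
  by rewrite (tauM i Ea) [tau i * (sg a * _)]mulrA (tauM i Esa); non_commutative_ring.
have {}a1 : a = 1 by apply: (div_mulrI q00); rewrite a1 mulr1.
have [qw _] : q1 = q1 + q0 * w /\ \forall i \near F, q i = p i.
  apply: skew_poly_uniq => //.
  apply: filterS2 qE (filterI tau0 ga) => i qE [t0 gi].
  apply: (div_mulIr t0); apply: (@addrI _ q0); rewrite -qE gi a1; non_commutative_ring.
have /div_mulf_eq0 : q0 * w = 0 by apply: (@addrI _ q1); rewrite addr0.
exact.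
Qed.

Lemma first_order_ext g h w : (\forall i \near F, g i = h i) ->
  first_order g w -> first_order h w.
Proof.
move=> gh Fg; elim: Fg h gh => {g w} [g g1|g w c g' Fg _ Ec gE|g w c g' Fg _ Ec gE] h gh.
- by apply: FirstOrder1; apply: filterS2 gh g1 => i <-.
- by apply: (FirstOrderM Fg Ec); apply: filterS2 gh gE => i <-.
- by apply: (FirstOrderV Fg Ec); apply: filterS2 gh gE => i <-.
Qed.

Lemma first_order_mul g w h v : first_order g w -> first_order h v ->
  first_order (fun i => g i * h i) (w + v).
Proof.
move=> Fg; elim=> {h v} [h h1|h v c h' Fh IH Ec hE|h v c h' Fh IH Ec hE].
- rewrite addr0; apply: first_order_ext Fg.
  by apply: filterS h1 => i ->; rewrite mulr1.
- rewrite addrA; apply: (FirstOrderM IH Ec).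
  by apply: filterS hE => i ->; rewrite mulrA.
- rewrite addrA; apply: (FirstOrderV IH Ec).
  by apply: filterS hE => i ->; rewrite mulrA.
Qed.

Lemma first_order_linear c : E c -> first_order (fun i => 1 + c * tau i) c.
Proof.
move=> Ec; rewrite -[X in first_order _ X]add0r.
have F1 : first_order (fun=> 1) 0 by apply: FirstOrder1; exact: nearW.
by apply: (FirstOrderM F1 Ec); apply: nearW => i; rewrite mul1r.
Qed.

Lemma first_order_inv g w : first_order g w ->
  first_order (fun i => (g i)^-1) (- w) /\ \forall i \near F, g i != 0.
Proof.
have F1 : first_order (fun=> 1) 0 by apply: FirstOrder1; exact: nearW.
elim=> {g w} [g g1|g w c g' Fg [IH g0] Ec gE|g w c g' Fg [IH g0] Ec gE].
- split; last by apply: filterS g1 => i ->; exact: oner_neq0.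
  by rewrite oppr0; apply: FirstOrder1; apply: filterS g1 => i ->; rewrite invr1.
- split; last first.
    by apply: filterS3 g0 (tau1 Ec) gE => i ? ? ->; exact: div_mulf_neq0.
  have FV : first_order (fun i => (1 + c * tau i)^-1) (0 - c).
    by apply: (FirstOrderV F1 Ec); apply: nearW => i; rewrite mul1r.
  rewrite opprD addrC -[- c]sub0r; apply: first_order_ext (first_order_mul FV IH).
  by apply: filterS3 g0 (tau1 Ec) gE => i ? ? ->; rewrite div_invMr.
- split; last first.
    apply: filterS3 g0 (tau1 Ec) gE => i ? ? ->; apply: div_mulf_neq0 => //.
    by rewrite invr_eq0.
  rewrite opprB addrC addrC; apply: first_order_ext (first_order_mul (first_order_linear Ec) IH).
  apply: filterS3 g0 (tau1 Ec) gE => i ? ? ->.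
  by rewrite div_invMr ?invrK // invr_eq0.
Qed.

(** Conjugation by [k] maps [1 + c tau] to [1 + k c sg(k^-1) tau]. *)
Lemma first_order_conj k g w : E k -> k != 0 -> first_order g w ->
  first_order (fun i => k * g i * k^-1) (k * w * sg k^-1).
Proof.
move=> Ek k0; have EkV := subringV sE Ek; have EskV := sgE EkV.
have lin c i : E c -> k * (1 + c * tau i) * k^-1 = 1 + k * c * sg k^-1 * tau i.
  move=> Ec; rewrite mulrDr mulr1 mulrDl div_mulrV // -(mulrA _ (sg _)) -tauM //.
  by rewrite !mulrA.
elim=> {g w} [g g1|g w c g' Fg IH Ec gE|g w c g' Fg IH Ec gE].
- rewrite mulr0 mul0r; apply: FirstOrder1; apply: filterS g1 => i ->.
  by rewrite mulr1 div_mulrV.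
- have Ec' : E (k * c * sg k^-1) by apply: subringM => //; exact: subringM.
  rewrite mulrDr mulrDl; apply: (FirstOrderM IH Ec').
  apply: filterS gE => i ->; rewrite -lin //.
  by rewrite !mulrA div_mulrVK.
- have Ec' : E (k * c * sg k^-1) by apply: subringM => //; exact: subringM.
  rewrite mulrBr mulrBl; apply: (FirstOrderV IH Ec').
  apply: filterS2 (tau1 Ec) gE => i t1 ->; rewrite -lin //.
  rewrite !div_invMr ?invrK ?invr_eq0 //; last exact: div_mulf_neq0.
  by rewrite !mulrA div_mulrVK.
Qed.

Lemma first_order_commutator k g w : E k -> k != 0 -> first_order g w ->
  first_order (fun i => g i * k * (g i)^-1 * k^-1) (w - k * w * sg k^-1).
Proof.
move=> Ek k0 Fg; have [FV g0] := first_order_inv Fg.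
have := first_order_mul Fg (first_order_conj Ek k0 FV).
rewrite mulrN mulNr; apply: first_order_ext; apply: nearW => i.
by rewrite !mulrA.
Qed.

Lemma first_order_iter m k g w : E k -> k != 0 -> first_order g w ->
  first_order (fun i => iter m (gcommut k) (g i))
              (iter m (fun v => v - k * v * sg k^-1) w).
Proof.
by move=> Ek k0 Fg; elim: m => [//|m IH] /=; exact: first_order_commutator.
Qed.

End FirstOrder.

(** A single element is a family indexed by [unit]. *)
Lemma skew_poly_at n (tau : D) E f : skew_poly (globally [set tt]) E (fun=> tau) n f ->
  exists2 e : nat -> D, forall j, E (e j) \/ e j = 0 & f tt = \sum_(j < n) e j * tau ^+ j.
Proof.
elim: n f => [|n IH] f /=.
  by move=> /(_ tt erefl) ->; exists (fun=> 0); [right|rewrite big_ord0].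
move=> [a [g [Ea /IH[e Ee gE] /(_ tt erefl) ->]]].
exists (fun j => if j is i.+1 then e i else a); first by case; [left|exact: Ee].
rewrite big_ord_recl expr0 mulr1 gE mulr_suml; congr (_ + _).
by apply: eq_bigr => j _; rewrite -mulrA -exprSr.
Qed.

(** The powers of [tau] are left independent over [E]. *)
Definition left_independent E (tau : D) := forall n (e : nat -> D), (forall j, E (e j)) ->
  \sum_(j < n) e j * tau ^+ j = 0 -> forall j, (j < n)%N -> e j = 0.

(** First application: [tau] is an element of [D] normalizing [E], with left
    independent powers. *)
Lemma skew_commutator_coef E (tau : D) m h a : div_subring E -> tau != 0 ->
  (forall e, E e -> E (tau * e * tau^-1)) -> (forall e, E e -> E (tau^-1 * e * tau)) ->
  left_independent E tau -> E h -> h != 0 -> E a ->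
  E (iter m (gcommut h) (1 + a * tau)) -> iter m (delta h) (a * tau) = 0.
Proof.
move=> sE t0 tE tE' ind Eh h0 Ea Ew.
pose F : set_system unit := globally [set tt].
have FF : Filter F by exact: globally_filter.
pose sg (e : D) := tau * e * tau^-1.
have sgS e : E e -> exists2 e', E e' & sg e' = e.
  move=> Ee; exists (tau^-1 * e * tau); first exact: tE'.
  by rewrite /sg -!mulrA div_mulVKr // div_mulrV // mulr1.
have tM (i : unit) e : E e -> tau * e = sg e * tau.
  by move=> _; rewrite /sg div_mulrVK.
have tau0 : \forall i \near F, tau != 0 by move=> i _.
have E0 := subring0 sE.
have tau1 c : E c -> \forall i \near F, 1 + c * tau != 0.
  move=> Ec i _; apply/eqP => e0.
  pose u j : D := if j is 0%N then 1 else if j is 1%N then c else 0.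
  have /eqP : u 0%N = 0.
    apply: (ind 2%N u) => //; first by case=> [|[|j]] //; exact: subring1.
    by rewrite big_ord_recl big_ord1 expr0 expr1 mulr1.
  by rewrite oner_eq0.
have indep n b f : E b -> skew_poly F E (fun=> tau) n f ->
    (\forall i \near F, b + f i * tau = 0) -> b = 0.
  move=> Eb /skew_poly_at[e Ee fE] /(_ tt erefl); rewrite fE => e0.
  apply: (ind n.+1 (fun j => if j is i.+1 then e i else b) _ _ 0%N) => //.
    by case=> // j; case: (Ee j) => // ->.
  rewrite big_ord_recl expr0 mulr1 -[RHS]e0 mulr_suml; congr (_ + _).
  by apply: eq_bigr => j _; rewrite -mulrA -exprSr.
have Fl := first_order_linear FF (fun=> tau) Ea.
have Fi := first_order_iter FF sE tE tM tau1 m Eh h0 Fl.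
have w0 : iter m (fun v => v - h * v * sg h^-1) a = 0.
  by apply: (first_order_const FF sE tE sgS tM tau0 tau1 indep Fi Ew) => i _.
suff -> : iter m (delta h) (a * tau) = iter m (fun v => v - h * v * sg h^-1) a * tau.
  by rewrite w0 mul0r.
elim: m {Ew Fi w0} => [//|m IH] /=; rewrite IH /delta mulrBl -(mulrA _ (sg _)).
by rewrite -tM ?mulrA //; exact: subringV.
Qed.

(** Second application: the indeterminate runs through infinitely many commuting
    elements [t i], and [E] is their centralizer.  The powers are independent
    because a nonzero polynomial has finitely many commuting roots. *)
Lemma infinite_commuting_coef (t : nat -> D) m h h' d w :
  injective t -> (forall i j, GRing.comm (t i) (t j)) ->
  (forall i, GRing.comm h (t i)) -> (forall i, GRing.comm h' (t i)) ->
  (forall i, GRing.comm d (t i)) -> (forall i, GRing.comm w (t i)) ->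
  h != 0 -> h' != 0 -> d != 0 ->
  (forall i, 1 + w * t i != 0 ->
    gcommut d (gcommut h' (iter m (gcommut h) (1 + w * t i))) = 1) ->
  delta d (delta h' (iter m (delta h) w)) = 0.
Proof.
move=> t_inj tC hC hC' dC wC h0 h0' d0 com1.
pose E : set D := [set x | forall i, GRing.comm x (t i)].
have sE : div_subring E.
  split=> [i|x y Ex Ey i|x y Ex Ey i|x Ex i].
  - exact/commr_sym/commr1.
  - by apply/commr_sym/commrB; apply/commr_sym.
  - by apply/commr_sym/commrM; apply/commr_sym.
  - exact/commr_inv.
have t_neq x : \forall i \near \oo, t i != x.
  have [[n tn]|nt] := pselect (exists n, t n = x).
    exists n.+1 => // i /= ni; rewrite -tn; apply: contraTneq ni => /t_inj ->.
    by rewrite ltnn.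
  by apply: nearW => i; apply/eqP => ti; apply: nt; exists i.
have tau1 c : E c -> \forall i \near \oo, 1 + c * t i != 0.
  move=> Ec; have [->|c0] := eqVneq c 0.
    by apply: nearW => i; rewrite mul0r addr0 oner_neq0.
  apply: filterS (t_neq (- c^-1)) => i; apply: contra_neq => e.
  by apply: (div_mulrI c0); rewrite mulrN div_mulrV // -[RHS]add0r -e addrAC subrr add0r.
have tM (i : nat) e : E e -> t i * e = id e * t i by move=> /(_ i).
have poly n f : skew_poly \oo E t n f ->
    exists e : nat -> D, \forall i \near \oo, f i = \sum_(j < n) e j * t i ^+ j.
  elim: n f => [|n IH] f /=.
    by move=> f0; exists (fun=> 0); apply: filterS f0 => i ->; rewrite big_ord0.
  move=> [a [g [Ea /IH[e gE] fE]]].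
  exists (fun j => if j is i.+1 then e i else a); apply: filterS2 gE fE => i gE ->.
  rewrite big_ord_recl expr0 mulr1 gE mulr_suml; congr (_ + _).
  by apply: eq_bigr => j _; rewrite -mulrA -exprSr.
have indep n b f : E b -> skew_poly \oo E t n f ->
    (\forall i \near \oo, b + f i * t i = 0) -> b = 0.
  move=> Eb /poly[e fE] fb.
  pose p := \poly_(j < n.+1) (if j is i.+1 then e i else b).
  have [N _ pr] : \forall i \near \oo, root p (t i).
    apply: filterS2 fE fb => i fE fb; rewrite /root horner_poly.
    apply/eqP; rewrite -[RHS]fb big_ord_recl expr0 mulr1 fE mulr_suml; congr (_ + _).
    by apply: eq_bigr => j _; rewrite -mulrA -exprSr.
  have [p0|p0] := eqVneq p 0.
    by have := coef_poly n.+1 (fun j => if j is i.+1 then e i else b) 0;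
      rewrite -/p p0 coef0.
  have := @max_ring_poly_roots _ p (map t (iota N (size p))) p0.
  rewrite size_map size_iota ltnn => H; suff : false by [].
  apply: H.
    by rewrite all_map; apply/allP => i; rewrite mem_iota => /andP[Ni _]; exact: pr.
  elim: (size p) N {pr} => //= k IH N; rewrite IH andbT all_map; apply/allP => i.
  rewrite mem_iota => /andP[Ni _] /=; rewrite /diff_roots tC eqxx hD //.
  rewrite subr_eq0; apply: contraTneq Ni => /t_inj ->; by rewrite ltnn.
have idS e : E e -> exists2 e', E e' & id e' = e by exists e.
have FF : Filter \oo by exact: _.
have idE e : E e -> E (id e) by [].
have [Ew Eh Eh' Ed] : [/\ E w, E h, E h' & E d] by [].
have Fl := first_order_linear FF t Ew.
have Fi := first_order_iter FF sE idE tM tau1 m Eh h0 Fl.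
have Fi' := first_order_commutator FF sE idE tM tau1 Eh' h0' Fi.
have Fd := first_order_commutator FF sE idE tM tau1 Ed d0 Fi'.
apply: (first_order_const FF sE idE idS tM (t_neq 0) tau1 indep Fd (subring1 sE)).
by apply: filterS (tau1 _ wC) => i; exact: com1.
Qed.

End DivisionRing.

(** * Finite and torsion division rings *)

(** The ring carried by a division-closed predicate. *)
Record sub_division (R : unitRingType) (S : divringClosed R) :=
  SubDivision { sub_division_val : R; sub_division_valP : sub_division_val \in S }.
HB.instance Definition _ (R : unitRingType) (S : divringClosed R) :=
  [isSub of sub_division S for @sub_division_val R S].
HB.instance Definition _ (R : unitRingType) (S : divringClosed R) :=
  [Choice of sub_division S by <:].
HB.instance Definition _ (R : unitRingType) (S : divringClosed R) :=
  [SubChoice_isSubUnitRing of sub_division S by <:].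

(** Wedderburn's little theorem for a finite division subring. *)
Lemma finite_division_comm (D : unitRingType) (E : set D) :
  division_ring D -> div_subring E -> finite_set E ->
  forall x y, E x -> E y -> GRing.comm x y.
Proof.
move=> hD sE /finite_seqP[s sEq] x y Ex Ey.
have memE z : (z \in s) = (z \in E).
  by rewrite sEq; apply/idP/idP => [zs|]; [rewrite inE|rewrite inE].
have cl : divring_closed (fun z : D => z \in s).
  split=> [|u v|u v]; rewrite -!topredE /= !memE !inE.
  - exact: subring1.
  - exact: subringB.
  - by move=> Eu Ev; apply: subringM => //; exact: subringV.
pose S : divringClosed D := HB.pack (fun z : D => z \in s) (GRing.isDivringClosed.Build D _ cl).
pose f (u : sub_division S) : seq_sub s := SeqSub (valP u : val u \in s).
pose g (u : seq_sub s) : sub_division S := @SubDivision D S (val u) (ssvalP u).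
have fgK : cancel f g by move=> u; exact: val_inj.
pose finR : finUnitRingType := 
  let cM := CanIsCountable (fgK : @cancel (seq_sub s : countType) _ f g) in
  let cT : countType := HB.pack (sub_division S) cM in
  HB.pack (sub_division S) cM (CanIsFinite (fgK : @cancel (seq_sub s : finType) cT f g)).
have dom : GRing.integral_domain_axiom finR.
  move=> u v /(congr1 val) /= uv0; apply/orP.
  have [u0|u0] := eqVneq u 0; first by left.
  right; apply/eqP/val_inj => /=; apply: (div_mulf_eq0 hD uv0).
  by apply: contra_neq u0 => u0; apply: val_inj.
have xS : x \in S by rewrite -[_ \in S]/(x \in s) memE inE.
have yS : y \in S by rewrite -[_ \in S]/(y \in s) memE inE.
have := finDomain_mulrC dom (SubDivision xS) (SubDivision yS).
by move=> /(congr1 val).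
Qed.

Section Torsion.
Variable D : unitRingType.
Hypothesis hD : division_ring D.
Implicit Types (x y z c k : D) (E A G : set D).

Lemma pigeonhole (T : choiceType) (A : set T) (f : nat -> T) :
  finite_set A -> (forall n, A (f n)) -> exists i j, (i < j)%N /\ f i = f j.
Proof.
move=> /finite_seqP[s ->] fs.
have : ~~ uniq (map f (iota 0 (size s).+1)).
  apply/negP => /(@uniq_leq_size _ _ s) us; suff: ((size s).+1 <= size s)%N by rewrite ltnn.
  by rewrite -(size_iota 0 (size s).+1) -(size_map f) us // => _ /mapP[i _ ->]; exact: fs.
move=> /(uniqPn (f 0%N))[i [j [ij]]]; rewrite size_map size_iota => js.
have is' := ltn_trans ij js.
rewrite !(nth_map 0%N) ?size_iota // !nth_iota // !add0n => fij.
by exists i, j.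
Qed.

Definition torsion x := exists2 n, (0 < n)%N & x ^+ n = 1.

Lemma finite_powers_torsion A x : finite_set A -> x != 0 ->
  (forall n, A (x ^+ n)) -> torsion x.
Proof.
move=> Af x0 Ax; have [i [j [ij xij]]] := pigeonhole Af Ax.
exists (j - i)%N; first by rewrite subn_gt0.
apply: (div_mulrI hD (div_expf_neq0 hD i x0)).
by rewrite -exprD subnKC ?(ltnW ij) // mulr1.
Qed.

Lemma torsion_neq0 x : torsion x -> x != 0.
Proof.
move=> [[//|n] _ xn]; apply: contra_eq_neq xn => ->.
by rewrite exprS mul0r eq_sym oner_neq0.
Qed.

Lemma torsionV x : torsion x -> exists n, x^-1 = x ^+ n.
Proof.
move=> xt; have x0 := torsion_neq0 xt; case: xt => [[//|n] _ xn]; exists n.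
by apply: (div_mulrI hD x0); rewrite -exprS xn div_mulrV.
Qed.

(** The order [n] of a torsion element. *)
Lemma torsion_order x : torsion x -> exists n, [/\ (0 < n)%N, x ^+ n = 1,
  forall m, (0 < m < n)%N -> x ^+ m != 1 & forall m, x ^+ m = x ^+ (m %% n)].
Proof.
move=> [n0 n0_gt0 xn0].
have ex : exists n, (0 < n)%N && (x ^+ n == 1) by exists n0; rewrite n0_gt0 xn0 eqxx.
case: (ex_minnP ex) => n /andP[n_gt0 /eqP xn] nmin; exists n; split=> // m.
  move=> /andP[m_gt0 mn]; apply/eqP => xm; have := nmin m.
  by rewrite m_gt0 xm eqxx leqNgt mn => /(_ erefl).
by rewrite {1}(divn_eq m n) exprD mulnC exprM xn expr1n mul1r.
Qed.

Lemma conj_expr k c n : k != 0 -> (k * c * k^-1) ^+ n = k * c ^+ n * k^-1.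
Proof.
move=> k0; elim: n => [|n IH]; first by rewrite !expr0 mulr1 div_mulrV.
by rewrite !exprS IH !mulrA div_mulrVK.
Qed.

(** If [c] has order [n], its powers are the only roots of ['X^n - 1] that commute
    with [c], a conjugate of [c] being a root. *)
Lemma torsion_conj_power c k : k != 0 -> torsion c ->
  GRing.comm c (k * c * k^-1) -> exists j, k * c * k^-1 = c ^+ j.
Proof.
move=> k0 ct; have c0 := torsion_neq0 ct.
have [n [n_gt0 cn cmin _]] := torsion_order ct; set c' := k * c * k^-1 => cc'.
have c'n : c' ^+ n = 1 by rewrite conj_expr // cn mulr1 div_mulrV.
apply/not_existsP => nc.
have := @max_ring_poly_roots _ ('X^n - 1%:P) (c' :: map (fun i => c ^+ i) (iota 0 n)).
rewrite -size_poly_eq0 size_XnsubC // /= size_map size_iota ltnn => H.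
suff : false by []; apply: H => //.
  apply/andP; split; first by rewrite /root hornerD hornerN hornerXn hornerC c'n subrr.
  rewrite all_map; apply/allP => i _ /=.
  by rewrite /root hornerD hornerN hornerXn hornerC -exprM mulnC exprM cn expr1n subrr.
apply/andP; split.
  rewrite all_map; apply/allP => i _ /=; rewrite /diff_roots.
  rewrite (commrX i (commr_sym cc')) eqxx /= hD //.
  by rewrite subr_eq0 eq_sym; apply/eqP; exact: nc.
have : (0 + n <= n)%N by [].
elim: {1 3}n 0%N => //= m IH i im; rewrite IH ?addSnnS // andbT all_map.
apply/allP => j; rewrite mem_iota => /andP[ij jm] /=; rewrite /diff_roots.
rewrite -!exprD addnC eqxx hD //= subr_eq0; apply/eqP => cij.
have : c ^+ (j - i) != 1.
  apply: cmin; rewrite subn_gt0 ij /= ltn_subLR; last exact: ltnW.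
  by rewrite ltn_addl // (leq_trans jm) // addSnnS.
apply/negP; rewrite negbK; apply/eqP.
apply: (div_mulrI hD (div_expf_neq0 hD i c0)).
by rewrite -exprD subnKC ?mulr1 // ltnW.
Qed.

Section Span.
Variables (G : set D) (N : nat).
Hypotheses (G_finite : finite_set G) (G1 : G 1).
Hypothesis GM : forall x y, G x -> G y -> G (x * y).
Hypotheses (N_gt0 : (0 < N)%N) (charN : N%:R = 0 :> D).

Lemma char_mulrn x n : x *+ n = x *+ (n %% N).
Proof. by rewrite {1}(divn_eq n N) mulrnDr mulrnA -[_ *+ N]mulr_natl charN mul0r add0r. Qed.

(** If a positive integer vanishes in [D], a finite multiplicative submonoid of
    [D] spans a finite subring, which is commutative by Wedderburn's theorem. *)
Lemma finite_monoid_comm x y : G x -> G y -> GRing.comm x y.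
Proof.
have /finite_seqP[s sG] := G_finite.
have Gs i : (i < size s)%N -> G s`_i by move=> ?; rewrite sG /= mem_nth.
pose A : set D := [set x | exists c : nat -> nat, x = \sum_(i < size s) s`_i *+ c i].
have AD u v : A u -> A v -> A (u + v).
  move=> [c ->] [d ->]; exists (fun i => c i + d i)%N.
  by rewrite -big_split; apply: eq_bigr => i _; rewrite mulrnDr.
have A0 : A 0 by exists (fun=> 0%N); rewrite big1.
have AMn u n : A u -> A (u *+ n).
  by move=> Au; elim: n => [|n IH]; rewrite ?mulr0n // mulrS; exact: AD.
have GA u : G u -> A u.
  rewrite {1}sG /= => us; have ui : (index u s < size s)%N by rewrite index_mem.
  exists (fun i => (i == index u s)%N : nat).
  rewrite (bigD1 (Ordinal ui)) //= eqxx mulr1n nth_index // big1 ?addr0 // => i ni.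
  by rewrite -val_eqE /= in ni; rewrite (negbTE ni).
have AN u : A u -> A (- u).
  move=> Au; suff -> : - u = u *+ N.-1 by exact: AMn.
  apply/eqP; rewrite eq_sym -addr_eq0 -mulrSr prednK //.
  by rewrite -mulr_natl charN mul0r.
have AM u v : A u -> A v -> A (u * v).
  move=> [c ->] [d ->]; rewrite mulr_suml.
  apply: (big_ind A) => // i _; rewrite mulr_sumr; apply: (big_ind A) => // j _.
  rewrite mulrnAr mulrnAl; apply/AMn/AMn/GA/GM; exact: Gs.
have Afin : finite_set A.
  pose S (f : {ffun 'I_(size s) -> 'I_N}) := \sum_(i < size s) s`_i *+ f i.
  apply: (@sub_finite_set _ _ (S @` setT)); last exact/finite_image/finite_finset.
  move=> u [c ->]; exists [ffun i : 'I_(size s) => Ordinal (ltn_pmod (c i) N_gt0)] => //.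
  by apply: eq_bigr => i _; rewrite ffunE /= -char_mulrn.
have AX u n : A u -> A (u ^+ n).
  move=> Au; elim: n => [|n IH]; first exact: GA.
  by rewrite exprS; exact: AM.
have sA : div_subring A.
  split=> // [|u v Au Av|u Au]; first exact: GA.
    by apply: AD => //; exact: AN.
  have [->|u0] := eqVneq u 0; first by rewrite invr0.
  have [n ->] := torsionV (finite_powers_torsion Afin u0 (fun n => AX u n Au)).
  exact: AX.
by move=> /GA Ax /GA Ay; exact: (finite_division_comm hD sA).
Qed.

End Span.

(** Under the hypotheses the products [c^i k^j] form a finite group. *)
Lemma torsion_conj_eq N c k : (0 < N)%N -> N%:R = 0 :> D -> torsion c -> torsion k ->
  GRing.comm c (k * c * k^-1) -> GRing.comm k c.
Proof.
move=> N_gt0 charN ct kt ckc; have k0 := torsion_neq0 kt.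
have [j kcj] := torsion_conj_power k0 ct ckc.
have kc : k * c = c ^+ j * k by rewrite -kcj div_mulrVK.
have kci i : k * c ^+ i = c ^+ (j * i) * k.
  elim: i => [|i IH]; first by rewrite muln0 !expr0 mulr1 mul1r.
  by rewrite exprSr mulrA IH -mulrA kc mulrA -exprD mulnSr.
have kic i i' : exists i'', k ^+ i * c ^+ i' = c ^+ i'' * k ^+ i.
  elim: i i' => [|i IH] i'; first by exists i'; rewrite expr0 mulr1 mul1r.
  have [l kl] := IH (j * i')%N; exists l.
  by rewrite exprSr -mulrA kci mulrA kl -!mulrA.
pose G : set D := [set x | exists i i', x = c ^+ i * k ^+ i'].
have [n [n_gt0 _ _ cmod]] := torsion_order ct.
have [m [m_gt0 _ _ kmod]] := torsion_order kt.
apply: (@finite_monoid_comm G N) => //.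
- pose S (f : 'I_n * 'I_m) := c ^+ f.1 * k ^+ f.2.
  apply: (@sub_finite_set _ _ (S @` setT)); last exact/finite_image/finite_finset.
  move=> _ [i [i' ->]].
  exists (Ordinal (ltn_pmod i n_gt0), Ordinal (ltn_pmod i' m_gt0)) => //.
  by rewrite /S /= -cmod -kmod.
- by exists 0%N, 0%N; rewrite mulr1.
- move=> _ _ [i [i' ->]] [l [l' ->]]; have [l'' kl] := kic i' l.
  exists (i + l'')%N, (i' + l')%N.
  by rewrite mulrA -(mulrA (c ^+ i)) kl !exprD !mulrA.
- by exists 0%N, 1%N; rewrite mul1r.
- by exists 1%N, 0%N; rewrite mulr1.
Qed.

Lemma pchar_exists n : (0 < n)%N -> n%:R = 0 :> D -> exists p, p \in [pchar D].
Proof.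
move=> n_gt0 n0; have ex : exists n, (0 < n)%N && (n%:R == 0 :> D).
  by exists n; rewrite n_gt0 n0 eqxx.
case: (ex_minnP ex) => p /andP[p_gt0 /eqP p0] pmin; exists p.
rewrite inE p0 eqxx andbT; apply/primeP; split.
  by case: p p_gt0 p0 {pmin} => [|[|p]] // _ /eqP; rewrite oner_eq0.
move=> d /dvdnP[e pe]; rewrite pe in p0 p_gt0 pmin *.
have [d0 e0] : (0 < d)%N /\ (0 < e)%N by apply/andP; rewrite andbC -muln_gt0.
have [e00|e00] := eqVneq (e%:R : D) 0.
  have := pmin e; rewrite e0 e00 eqxx => /(_ isT); rewrite -{2}(muln1 e) leq_pmul2l //.
  by move=> d1; apply/orP; left; rewrite eqn_leq d1 d0.
have /eqP d00 : (d%:R : D) = 0 by apply: (div_mulf_eq0 hD _ e00); rewrite -natrM.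
have := pmin d; rewrite d0 d00 => /(_ isT); rewrite -{2}(mul1n d) leq_pmul2r // => e1.
apply/orP; right; have -> : e = 1%N by apply/eqP; rewrite eqn_leq e1 e0.
by rewrite mul1n.
Qed.

Lemma char_of_finite A : finite_set A -> (forall n, A n%:R) -> exists p, p \in [pchar D].
Proof.
move=> Af An; have [i [j [ij nij]]] := pigeonhole Af An.
apply: (@pchar_exists (j - i)); first by rewrite subn_gt0.
by rewrite natrB ?(ltnW ij) // nij subrr.
Qed.

Lemma pchar_expr_eq1 p x : p \in [pchar D] -> x ^+ p = 1 -> x = 1.
Proof.
move=> pD xp; have := pFrobenius_autB_comm pD (commr1 x).
rewrite !pFrobenius_autE xp expr1n subrr => xp1.
apply/eqP; rewrite -subr_eq0; apply/eqP; apply: contra_eq xp1.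
exact: div_expf_neq0.
Qed.

Lemma pchar_order p n x : p \in [pchar D] -> (0 < n)%N -> x ^+ n = 1 ->
  (forall m, (0 < m < n)%N -> x ^+ m != 1) -> (n%:R : D) != 0.
Proof.
move=> pD n_gt0 xn xmin; rewrite -(dvdn_pcharf pD); apply/negP => /dvdnP[m nE].
have p1 := prime_gt1 (pcharf_prime pD).
have m_gt0 : (0 < m)%N by move: n_gt0; rewrite nE muln_gt0 => /andP[].
have mn : (0 < m < n)%N by rewrite m_gt0 nE ltn_Pmulr.
have xm : x ^+ m = 1 by apply: (pchar_expr_eq1 pD); rewrite -exprM -nE.
by have := xmin m mn; rewrite xm eqxx.
Qed.

End Torsion.

Section Dependence.
Variable D : unitRingType.
Hypothesis hD : division_ring D.
Implicit Types (x y z c k a d : D) (E A P : set D).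

(** The elements of [D] commuting with all elements of [A]. *)
Definition centralizer A : set D := [set y | forall x, A x -> GRing.comm y x].

Lemma centralizer_div_subring A : div_subring (centralizer A).
Proof.
split=> [x _|x y Cx Cy z Az|x y Cx Cy z Az|x Cx z Az].
- exact/commr_sym/commr1.
- by apply/commr_sym/commrB; apply/commr_sym; [exact: Cx|exact: Cy].
- by apply/commr_sym/commrM; apply/commr_sym; [exact: Cx|exact: Cy].
- by apply/commr_inv/Cx.
Qed.

Lemma center_div_subring : div_subring (@ring_center D).
Proof.
have -> : @ring_center D = centralizer setT.
  by apply/seteqP; split=> z zC y; [move=> _|]; exact: zC.
exact: centralizer_div_subring.
Qed.

Lemma infinite_injection (T : choiceType) (A : set T) : ~ finite_set A ->
  exists2 f : nat -> T, injective f & forall n, A (f n).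
Proof.
move=> /infiniteP/card_leP/unsquash f.
exists (fun n => val (f (to_setT n))) => [i j|n]; last by have := valP (f (to_setT n)); rewrite inE.
move=> /val_inj fij; have := @inj _ _ setT f _ _ (mem_setT _) (mem_setT _) fij.
by move=> /(congr1 val).
Qed.

(** Jacobson's theorem for a torsion division ring of characteristic [p].  If [a],
    of order [n], does not commute with [d], the component [w] of [d] on some
    eigenvalue [a^i <> 1] of conjugation by [a] is nonzero; then [w a w^-1] is a
    power of [a] other than [a], which [torsion_conj_eq] forbids. *)
Lemma torsion_division_comm p P : p \in [pchar D] -> div_subring P ->
  (forall x, P x -> x != 0 -> torsion x) ->
  forall a d, P a -> P d -> GRing.comm a d.
Proof.
move=> pD sP Pt a d Pa Pd.
have [->|a0] := eqVneq a 0; first exact/commr_sym/commr0.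
have [n [n_gt0 an amin amod]] := torsion_order (Pt a Pa a0).
have n0 := pchar_order hD pD n_gt0 an amin.
apply: contrapT => nad.
have aX0 i : a ^+ i != 0 by exact: div_expf_neq0.
pose g i j := a ^- (i * j) * (a ^+ j * d * a ^- j).
pose w i := \sum_(j < n) g i j.
(* [w i] is the component of [d] on the eigenvalue [a^i] of conjugation by [a] *)
have gn i : g i n = g i 0%N.
  by rewrite /g muln0 !expr0 an mulnC exprM an expr1n.
have gS i j : a * g i j * a^-1 = a ^+ i * g i j.+1.
  have aC : a * a ^- (i * j) = a ^- (i * j) * a by apply/commrV/commrX.
  have aiV : a ^+ i * a ^- (i * j.+1) = a ^- (i * j).
    rewrite mulnS exprD div_invMr // -(_ : GRing.comm (a ^- i) (a ^- (i * j))).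
      by rewrite div_mulVKr.
    exact/commrV/commrX/commr_inv/commr_sym/commrX/commr_refl.
  rewrite /g mulrA aC -!mulrA; rewrite [in RHS]mulrA aiV; congr (_ * _).
  by rewrite exprS div_invMr // -!mulrA.
have wa i : a * w i * a^-1 = a ^+ i * w i.
  rewrite /w mulr_sumr mulr_suml mulr_sumr.
  under eq_bigr => j _ do rewrite gS.
  rewrite -!mulr_sumr; congr (_ * _).
  case: n n_gt0 gn {an amin amod n0} @w => // n _ gn w.
  by rewrite [in RHS]big_ord_recl /= [in LHS]big_ord_recr /= gn addrC.
have gsum j : (j < n)%N -> \sum_(i < n) g i j = (if j == 0%N then n%:R * d else 0).
  move=> jn; rewrite -mulr_suml.
  have [->|j0] := eqVneq j 0%N.
    rewrite expr0 mul1r invr1 mulr1; congr (_ * d).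
    under eq_bigr => i _ do rewrite muln0 expr0 invr1.
    by rewrite sumr_const card_ord.
  suff -> : \sum_(i < n) a ^- (i * j) = 0 by rewrite mul0r.
  have aj : a ^+ j != 1 by apply: amin; rewrite lt0n j0.
  have -> : \sum_(i < n) a ^- (i * j) = \sum_(i < n) a ^- j ^+ i.
    by apply: eq_bigr => i _; rewrite exprVn -exprM mulnC.
  have aVn : a ^- j ^+ n = 1 by rewrite exprVn -exprM mulnC exprM an expr1n invr1.
  have := subrX1 (a ^- j) n; rewrite aVn subrr => /esym/(div_mulf_eq0 hD).
  by apply; rewrite subr_eq0 invr_eq1.
have [[i [in0 wi0]]|nw] := pselect (exists i, (0 < i < n)%N /\ w i != 0).
  have Pw : P (w i).
    rewrite /w; apply: (big_ind P) => [|u v|j _]; [exact: subring0|exact: subringD|].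
    apply: subringM => //; first by apply: subringV => //; exact: subringX.
    apply: subringM => //; last by apply: subringV => //; exact: subringX.
    by apply: subringM => //; exact: subringX.
  have wt := Pt _ Pw wi0.
  have waw : w i * a * (w i)^-1 = a ^- i * a.
    apply: (div_mulIr hD wi0); rewrite div_mulrVK //.
    apply: (div_mulrI hD (aX0 i)); rewrite !mulrA -wa div_mulrVK // div_mulrV // mul1r //.
  have wc : GRing.comm (w i) a.
    apply: (torsion_conj_eq hD (prime_gt0 (pcharf_prime pD)) (pcharf0 pD)) => //.
      exact: Pt.
    rewrite waw; apply: commrM; last exact: commr_refl.
    exact/commrV/commrX.
  have /negP := amin i in0; apply; apply/eqP.
  have : a = a ^- i * a by rewrite -waw wc div_mulrK.
  move=> /(congr1 (fun x => a ^+ i * x * a^-1)).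
  by rewrite mulrA !div_mulrK // !div_mulrV.
(* the components add up to [n d], and [w 0] commutes with [a] *)
have nd : n%:R * d = w 0%N.
  transitivity (\sum_(i < n) w i).
    rewrite exchange_big /= (bigD1 (Ordinal n_gt0)) //= gsum // big1 ?addr0 // => j j0.
    by rewrite gsum // -[_ == 0%N]/(j == Ordinal n_gt0) (negbTE j0).
  rewrite (bigD1 (Ordinal n_gt0)) //= big1 ?addr0 // => j j0.
  apply/eqP; apply: contrapT => wj; apply: nw; exists j.
  by split; [rewrite lt0n ltn_ord andbT|exact/negP].
apply: nad; apply: (div_mulrI hD n0).
have := wa 0%N; rewrite expr0 mul1r -nd => /(congr1 (fun x => x * a)).
rewrite div_mulrVK // => e.
by rewrite mulrA -(commr_nat a n) -mulrA e mulrA.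
Qed.

(** In a left dependence relation of minimal length with constant term 1, every
    term [e j tau^j] commutes with [E]: the difference between the relation and
    its conjugate by [l] in [E] is shorter. *)
Lemma left_dependence E (tau : D) : div_subring E -> tau != 0 ->
  (forall e, E e -> E (tau * e * tau^-1)) -> ~ left_independent E tau ->
  exists m (e : nat -> D), [/\ forall j, E (e j), e 0%N = 1,
    1 + \sum_(j < m) e j.+1 * tau ^+ j.+1 = 0 &
    forall j l, (j <= m)%N -> E l -> GRing.comm l (e j * tau ^+ j)].
Proof.
move=> sE t0 tE nind.
pose rel n := exists e : nat -> D, [/\ forall j, E (e j),
  \sum_(j < n) e j * tau ^+ j = 0 & exists2 j, (j < n)%N & e j != 0].
have ex : exists n, `[< rel n >].
  apply: contrapT => nex; apply: nind => n e Ee e0 j jn; apply: contrapT => /eqP ej0.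
  by apply: nex; exists n; apply/asboolP; exists e; split=> //; exists j.
case: (ex_minnP ex) => -[|n] /asboolP[e [Ee e0 [j jn ej0]]] // nmin.
have shift (u : nat -> D) : (forall j, E (u j)) ->
    \sum_(j < n) u j.+1 * tau ^+ j.+1 = 0 -> forall j, (j < n)%N -> u j.+1 = 0.
  move=> Eu u0 i i_n; apply: contrapT => /eqP ui0.
  suff /asboolP/nmin : rel n by rewrite ltnn.
  exists (fun j => u j.+1); split=> //; last by exists i.
  apply: (div_mulIr hD t0); rewrite mul0r -[RHS]u0 mulr_suml.
  by apply: eq_bigr => l _; rewrite -mulrA -exprSr.
(* otherwise the relation could be divided by [tau] on the right *)
have e00 : e 0%N != 0.
  apply: contra_neq ej0 => e00; case: j jn => [//|j] jn.
  apply: shift jn => //; rewrite -[RHS]e0 big_ord_recl e00 mul0r add0r.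
  by apply: eq_bigr.
have EV := subringV sE (Ee 0%N).
pose u j := (e 0%N)^-1 * e j.
have u00 : u 0%N = 1 by rewrite /u div_mulVr.
have Eu i : E (u i) by exact: subringM.
have u0 : 1 + \sum_(i < n) u i.+1 * tau ^+ i.+1 = 0.
  transitivity ((e 0%N)^-1 * \sum_(i < n.+1) e i * tau ^+ i); last by rewrite e0 mulr0.
  rewrite big_ord_recl mulrDr expr0 mulr1 div_mulVr // mulr_sumr; congr (_ + _).
  by apply: eq_bigr => i _; rewrite lift0 mulrA.
exists n, u; split=> // i l i_n El.
have tX0 m : tau ^+ m != 0 by exact: div_expf_neq0.
pose sl m := tau ^+ m * l * tau ^- m.
have Esl m : E (sl m).
  elim: m => [|m IH]; first by rewrite /sl expr0 invr1 mulr1 mul1r.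
  by have := tE _ IH; rewrite /sl exprS div_invMr // !mulrA.
have slE m : tau ^+ m * l = sl m * tau ^+ m by rewrite /sl div_mulrVK.
pose v m := l * u m - u m * sl m.
have Ev m : E (v m) by apply: subringB => //; apply: subringM.
have vE m : v m * tau ^+ m = l * (u m * tau ^+ m) - u m * tau ^+ m * l.
  by rewrite -mulrA slE; rewrite /v; non_commutative_ring.
have v0 : \sum_(j < n) v j.+1 * tau ^+ j.+1 = 0.
  under eq_bigr => m _ do rewrite vE.
  rewrite sumrB -mulr_sumr -mulr_suml.
  have -> : \sum_(i < n) u i.+1 * tau ^+ i.+1 = -1.
    by apply/eqP; rewrite -addr_eq0 addrC u0.
  by rewrite mulN1r mulrN1 subrr.
case: i i_n => [_|i i_n]; first by rewrite u00 expr0 mulr1; exact: commr1.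
have := shift v Ev v0 i i_n => /(congr1 (fun x => x * tau ^+ i.+1)).
by rewrite vE mul0r => /eqP; rewrite subr_eq0 => /eqP.
Qed.

(** An element algebraic over a finite division ring that it centralizes is
    torsion. *)
Lemma finite_dependent_torsion E c : finite_set E -> div_subring E -> c != 0 ->
  (forall e, E e -> GRing.comm e c) -> ~ left_independent E c -> torsion c.
Proof.
move=> Efin sE c0 Ec nind.
have [m [e [Ee e0 em _]]] : exists m (e : nat -> D), [/\ forall j, E (e j), e 0%N = 1,
    1 + \sum_(j < m) e j.+1 * c ^+ j.+1 = 0 &
    forall j l, (j <= m)%N -> E l -> GRing.comm l (e j * c ^+ j)].
  apply: left_dependence => // x Ex.
  by rewrite -(Ec _ Ex) div_mulrK.
(* the relation expresses c^-1 by lower powers *)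
have cV : c^-1 = \sum_(j < m) - e j.+1 * c ^+ j.
  apply: (div_mulIr hD c0); rewrite div_mulVr // mulr_suml.
  apply/eqP; rewrite -subr_eq0 -sumrN -[X in _ == X]em; apply/eqP; congr (_ + _).
  by apply: eq_bigr => j _; rewrite !mulNr opprK -mulrA -exprSr.
case: m => [|m] in em cV *.
  by move: cV => /eqP; rewrite big_ord0 invr_eq0 (negbTE c0).
pose A : set D := [set x | exists2 u : nat -> D, forall j, E (u j) &
  x = \sum_(j < m.+1) u j * c ^+ j].
have Afin : finite_set A.
  have /finite_seqP[s sE'] := Efin.
  pose S (f : {ffun 'I_m.+1 -> seq_sub s}) := \sum_(j < m.+1) val (f j) * c ^+ j.
  apply: (@sub_finite_set _ _ (S @` setT)); last exact/finite_image/finite_finset.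
  move=> _ [u Eu ->].
  have us j : u j \in s by have := Eu j; rewrite sE'.
  by exists [ffun j : 'I_m.+1 => SeqSub (us j)] => //; apply: eq_bigr => j _; rewrite ffunE.
have AV x : A x -> A (c^-1 * x).
  move=> [u Eu ->].
  exists (fun j => u 0%N * - e j.+1 + (if (j < m)%N then u j.+1 else 0)) => [j|].
    apply: subringD => //; first by apply: subringM => //; exact: subringN.
    by case: ifP => _ //; exact: subring0.
  have cu j : GRing.comm c^-1 (u j) by apply/commr_inv/commr_sym/Ec.
  transitivity (\sum_(j < m.+1) u 0%N * - e j.+1 * c ^+ j + \sum_(j < m) u j.+1 * c ^+ j).
    rewrite big_ord_recl mulrDr expr0 mulr1 cu cV !mulr_sumr; congr (_ + _).
      by apply: eq_bigr => j _; rewrite mulrA.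
    rewrite -cV; apply: eq_bigr => j _.
    by rewrite lift0 mulrA cu -mulrA exprS div_mulKr.
  under [in RHS]eq_bigr => j _ do rewrite mulrDl.
  rewrite big_split /=; congr (_ + _).
  rewrite big_ord_recr /= ltnn mul0r addr0; apply: eq_bigr => j _.
  by rewrite ltn_ord.
have A1 : A 1.
  exists (fun j => if j == 0%N then 1 else 0) => [j|].
    by case: ifP => _; [exact: subring1|exact: subring0].
  by rewrite big_ord_recl expr0 mulr1 big1 ?addr0 // => j _; rewrite lift0 mul0r.
have cVt : torsion c^-1.
  apply: (finite_powers_torsion hD Afin); first by rewrite invr_eq0.
  elim=> [|n IH]; first by rewrite expr0.
  by rewrite exprS; exact: AV.
case: cVt => n n_gt0 cn; exists n => //.
by apply/eqP; rewrite -invr_eq1 -exprVn cn.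
Qed.

End Dependence.

(** * Commutators with a subnormal subgroup *)

Section Subnormal.
Variable D : unitRingType.
Hypothesis hD : division_ring D.
Implicit Types (x y z c h k a b d u w : D) (E F K L M P Q : set D).

Local Notation Z := (@ring_center D).

Lemma iter_delta_eigen m h q w : h != 0 -> GRing.comm h q ->
  delta h w = q * w -> iter m (delta h) w = q ^+ m * w.
Proof.
move=> h0 hq hw; elim: m => [|m IH]; first by rewrite expr0 mul1r.
have hqm : GRing.comm h (q ^+ m) by exact: commrX.
rewrite iterS IH /delta mulrA hqm -!mulrA -mulrBr (mulrA h) -/(delta h w) hw.
by rewrite mulrA -exprSr.
Qed.

Lemma iter_deltaMr m h w b : h != 0 -> GRing.comm h b ->
  iter m (delta h) (w * b) = iter m (delta h) w * b.
Proof.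
move=> h0 hb; elim: m => [//|m IH]; rewrite !iterS IH /delta mulrBl; congr (_ - _).
by rewrite -!mulrA -(commr_inv hb).
Qed.

Lemma gcommut_neq0 h x : h != 0 -> x != 0 -> gcommut h x != 0.
Proof.
move=> h0 x0; rewrite /gcommut.
by do !apply: (div_mulf_neq0 hD) => //; rewrite invr_eq0.
Qed.

Lemma gcommut_eq1 h x : h != 0 -> x != 0 -> gcommut h x = 1 <-> GRing.comm x h.
Proof.
move=> h0 x0; split=> [/(congr1 (fun y => y * h * x))|xh].
  by rewrite /gcommut !div_mulrVK // mul1r.
by rewrite /gcommut xh div_mulrK // div_mulrV.
Qed.

(** Subgroups of the multiplicative group, as sets of elements of [D]. *)
Definition mult_subgroup K := [/\ K 1, forall x, K x -> x != 0,
  forall x y, K x -> K y -> K (x * y) & forall x, K x -> K x^-1].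

(** [K] is a subnormal subgroup of the multiplicative group of [D], with a chain
    of length [n]. *)
Fixpoint subnormal_depth n K : Prop :=
  if n is m.+1 then
    exists H, [/\ subnormal_depth m H, mult_subgroup K, K `<=` H &
                forall h x, H h -> K x -> K (h * x * h^-1)]
  else K = [set x | x != 0].

Lemma subnormal_depth_subgroup n K : subnormal_depth n K -> mult_subgroup K.
Proof.
case: n => [->|n [H []]] //; split=> /= [|//|x y|x]; rewrite ?oner_neq0 ?invr_eq0 //.
exact: (div_mulf_neq0 hD).
Qed.

(** All commutators [[x, k_1, .., k_n]] with the [k_i] in [K] belong to [Q]. *)
Fixpoint commutators_in K n Q x : Prop :=
  if n is m.+1 then forall k, K k -> commutators_in K m Q (gcommut k x) else Q x.

Lemma commutators_in_sub K K' n Q Q' x : K `<=` K' -> Q' `<=` Q ->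
  commutators_in K' n Q' x -> commutators_in K n Q x.
Proof.
move=> KK' QQ'; elim: n x => [|n IH] x /=; first exact: QQ'.
by move=> H k Kk; apply/IH/H/KK'.
Qed.

Lemma commutators_inS K n Q x :
  commutators_in K n (fun y => forall k, K k -> Q (gcommut k y)) x ->
  commutators_in K n.+1 Q x.
Proof.
elim: n x => [//|n IH] x H k Kk; exact/IH/H.
Qed.

Lemma commutators_in_iter K n Q x k : commutators_in K n Q x -> K k ->
  Q (iter n (gcommut k) x).
Proof.
by move=> H Kk; elim: n x H => [//|n IH] x H; rewrite iterSr; apply/IH/H.
Qed.

(** Each commutator descends one step of the chain. *)
Lemma subnormal_commutators n K x : subnormal_depth n K -> x != 0 ->
  commutators_in K n K x.
Proof.
elim: n K x => [|n IH] K x; first by move=> /= ->.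
move=> [H [sH gK KH HK]] x0; apply: commutators_inS.
have [_ KN0 KM KV] := gK.
apply: (commutators_in_sub KH _ (IH _ _ sH x0)) => y Hy k Kk.
by apply: KM; [exact: HK|exact: KV].
Qed.

(** [K] normalizes [P]. *)
Definition normalized K P := forall k x, K k -> P x -> P (k * x * k^-1).

Lemma normalized_commut K P k x : div_subring P -> normalized K P -> K k -> P x ->
  P (gcommut k x).
Proof.
move=> sP nP Kk Px; rewrite /gcommut -!mulrA (mulrA k); apply: subringM => //.
by apply: nP => //; exact: subringV.
Qed.

Lemma normalized_commut_l K P k x : div_subring P -> normalized K P -> K k -> P x ->
  P (gcommut x k).
Proof.
move=> sP nP Kk Px; rewrite /gcommut; apply: subringM => //; last exact: subringV.
exact: nP.
Qed.

Lemma centralizer_normalized K M : mult_subgroup K ->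
  (forall k m, K k -> M m -> M (k * m * k^-1)) -> normalized K (centralizer M).
Proof.
move=> [_ K0 _ KV] KM k x Kk Cx m Mm.
have k0 := K0 _ Kk; have := Cx _ (KM _ _ (KV _ Kk) Mm); rewrite invrK.
move=> /(congr1 (fun y => k * y * k^-1)); rewrite !mulrA.
by rewrite /GRing.comm !mulrA div_mulrV // mul1r div_mulrK.
Qed.

(** In this section [K] is subnormal and its centralizer is central. *)
Section InductionStep.
Variables (n : nat) (K : set D).
Hypothesis sK : subnormal_depth n K.
Hypothesis CK : centralizer K `<=` Z.

Let gK := subnormal_depth_subgroup sK.
Let K_neq0 k : K k -> k != 0. Proof. by case: gK => _ + _ _; apply. Qed.
Let KV k : K k -> K k^-1. Proof. by case: gK => _ _ _; apply. Qed.

Lemma infinite_injection_comm A x k : ~ finite_set A -> A `<=` Z ->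
  exists t : nat -> D, [/\ injective t, forall i j, GRing.comm (t i) (t j),
    forall i, GRing.comm x (t i) & forall i, GRing.comm k (t i)].
Proof.
move=> /infinite_injection[t ti tA] AZ; exists t; split=> // [i j|i|i].
- exact: AZ (tA _) _.
- by apply/commr_sym; exact: AZ (tA _) _.
- by apply/commr_sym; exact: AZ (tA _) _.
Qed.

(** The powers of an element of infinite order form an infinite commuting
    family. *)
Lemma not_torsion_powers x c d m : x != 0 -> ~ torsion x -> (0 < m)%N ->
  GRing.comm c (x ^+ m) -> GRing.comm d (x ^+ m) ->
  exists t : nat -> D, [/\ injective t, forall i j, GRing.comm (t i) (t j),
    forall i, GRing.comm c (t i) & forall i, GRing.comm d (t i)].
Proof.
move=> x0 xt m_gt0 cx dx; exists (fun i => (x ^+ m) ^+ i); split=> [i j|i j|i|i].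
- wlog ij : i j / (i <= j)%N.
    by move=> W e; case/orP: (leq_total i j) => ij; [exact: W|apply/esym/W].
  move=> e; apply/eqP; rewrite eqn_leq ij leqNgt; apply/negP => ji.
  apply: xt; exists (m * (j - i))%N; first by rewrite muln_gt0 m_gt0 subn_gt0.
  rewrite exprM; apply: (div_mulrI hD (div_expf_neq0 hD i (div_expf_neq0 hD m x0))).
  by rewrite -exprD subnKC // mulr1.
- exact/commrX/commr_sym/commrX.
- exact: commrX.
- exact: commrX.
Qed.

(** An element whose commutators with [K] are all central is central.  If
    [x k = z k x] with [z <> 1] central, the first-order argument is applied to
    [1 + x k t]: the commutator of [[1 + x k t, k, .., k]] with [x] is central,
    while [x k] is an eigenvector of both [delta k] and [delta x], for the
    nonzero eigenvalues [1 - z^-1] and [1 - z]. *)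
Lemma central_commutators x : (forall k, K k -> Z (gcommut k x)) -> Z x.
Proof.
move=> xK; have [->|x0] := eqVneq x 0; first by move=> y; apply/commr_sym/commr0.
apply: CK => k Kk; apply: contrapT => nxk.
have k0 := K_neq0 Kk.
have [z [Zz xkE z0]] : exists z, [/\ Z z, x * k = z * (k * x) & z != 0].
  exists (gcommut k x); split; [exact: xK| |exact: gcommut_neq0].
  by rewrite /gcommut -!mulrA div_mulKr // div_mulVr // mulr1.
have z1 : z != 1.
  by apply/eqP => z1; apply: nxk; rewrite /GRing.comm xkE z1 mul1r.
have zC y : z * y = y * z by exact: Zz.
have zX j y : z ^+ j * y = y * z ^+ j by apply/commr_sym/commrX/commr_sym/Zz.
have xkX j : x * k ^+ j = z ^+ j * (k ^+ j * x).
  elim: j => [|j IH]; first by rewrite !expr0 !mulr1 !mul1r.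
  rewrite exprSr mulrA IH -!mulrA xkE (exprSr z) -!mulrA; congr (_ * _).
  by rewrite (mulrA _ z) -zC -!mulrA.
have xXk j : x ^+ j * k = z ^+ j * (k * x ^+ j).
  elim: j => [|j IH]; first by rewrite !expr0 !mulr1 !mul1r.
  by rewrite exprS -mulrA IH mulrA -zX -mulrA (mulrA x) xkE exprSr -!mulrA.
have [t [t_inj tC xt kt]] : exists t : nat -> D, [/\ injective t,
    forall i j, GRing.comm (t i) (t j),
    forall i, GRing.comm x (t i) & forall i, GRing.comm k (t i)].
  have [Zfin|] := pselect (finite_set Z); last first.
    by move=> /infinite_injection_comm; apply.
  have sZ := center_div_subring D.
  have [N N_gt0 zN] : torsion z.
    exact: (finite_powers_torsion hD Zfin z0 (fun j => subringX sZ j Zz)).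
  have [p pD] : exists p, p \in [pchar D].
    by apply: (char_of_finite hD Zfin) => j y; exact/commr_sym/commr_nat.
  have [xt|nxt] := pselect (torsion x); last first.
    apply: (not_torsion_powers x0 nxt N_gt0); first exact/commrX/commr_refl.
    by rewrite /GRing.comm xXk zN mul1r.
  have [kt|nkt] := pselect (torsion k); last first.
    apply: (not_torsion_powers k0 nkt N_gt0); last exact/commrX/commr_refl.
    by rewrite /GRing.comm xkX zN mul1r.
  case: nxk; apply/commr_sym.
  apply: (torsion_conj_eq hD (prime_gt0 (pcharf_prime pD)) (pcharf0 pD)) => //.
  have -> : k * x * k^-1 = z^-1 * x.
    by apply: (div_mulrI hD z0); rewrite div_mulVKr // mulrA -xkE div_mulrK.
  by apply: commrM; [apply/commrV/commr_sym/Zz|exact: commr_refl].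
have zVC : GRing.comm k (1 - z^-1).
  by apply: commrB; [exact: commr1|apply/commrV/commr_sym/Zz].
have dk : delta k (x * k) = (1 - z^-1) * (x * k).
  rewrite /delta mulrBl mul1r; congr (_ - _).
  by rewrite mulrA div_mulrK // xkE div_mulKr.
have dx u : GRing.comm x u -> delta x (u * (x * k)) = u * (1 - z) * (x * k).
  move=> xu; rewrite /delta.
  have -> : x * (u * (x * k)) * x^-1 = u * (x * (x * k) * x^-1).
    by rewrite !mulrA xu.
  rewrite {2}xkE.
  have -> : x * (z * (k * x)) * x^-1 = z * (x * k).
    by rewrite !mulrA div_mulrK // -zC.
  by non_commutative_ring.
have xz u : GRing.comm x u -> GRing.comm x (u * (1 - z)).
  by move=> xu; apply: commrM => //; apply: commrB; [exact: commr1|apply/commr_sym/Zz].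
have xzV : GRing.comm x ((1 - z^-1) ^+ n).
  by apply: commrX; apply: commrB; [exact: commr1|apply/commrV/commr_sym/Zz].
have := infinite_commuting_coef hD (m := n) (w := x * k) t_inj tC kt xt xt _ k0 x0 x0.
rewrite (iter_delta_eigen n k0 zVC dk) (dx _ xzV) (dx _ (xz _ xzV)) => H.
have /eqP : (1 - z^-1) ^+ n * (1 - z) * (1 - z) * (x * k) = 0.
  apply: H => i; first by apply/commr_sym/commrM; apply/commr_sym.
  move=> r0; set r := iter n _ _.
  have Kr : K r by apply: commutators_in_iter (subnormal_commutators sK r0) Kk.
  have r_neq0 := K_neq0 Kr.
  apply/(gcommut_eq1 x0); first exact: gcommut_neq0.
  rewrite /GRing.comm; suff : Z (gcommut x r) by move=> ->.
  (* the commutators of r with x and of x with r are mutually inverse *)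
  have -> : gcommut x r = (gcommut r x)^-1.
    apply: (div_mulrI hD (gcommut_neq0 r_neq0 x0)); rewrite div_mulrV ?gcommut_neq0 //.
    by rewrite /gcommut !mulrA !(div_mulrVK, div_mulrK, div_mulrV) // ?invr_eq0.
  by move=> y; apply/commr_inv/xK.
have z1' : 1 - z != 0 by rewrite subr_eq0 eq_sym.
have zV1 : 1 - z^-1 != 0 by rewrite subr_eq0 eq_sym invr_eq1.
apply/negP; apply: (div_mulf_neq0 hD); last exact: (div_mulf_neq0 hD).
apply: (div_mulf_neq0 hD) => //; apply: (div_mulf_neq0 hD) => //.
exact: (div_expf_neq0 hD).
Qed.

Lemma central_iterated_commutators m x : x != 0 -> commutators_in K m Z x -> Z x.
Proof.
elim: m x => [//|m IH] x x0 /= xK; apply: central_commutators => k Kk.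
by apply: IH (xK k Kk); apply: gcommut_neq0 => //; exact: K_neq0.
Qed.

Lemma normalized_commutators m P x : div_subring P -> normalized K P -> P x ->
  commutators_in K m P x.
Proof.
move=> sP nP; elim: m x => [//|m IH] x Px k Kk.
by apply: IH; exact: (normalized_commut sP nP Kk Px).
Qed.

Lemma normalized_noncentral P : div_subring P -> normalized K P -> ~ P `<=` Z ->
  exists c, [/\ P c, K c & ~ Z c].
Proof.
move=> sP nP nPZ; apply: contrapT => nc; apply: nPZ => x Px.
have [->|x0] := eqVneq x 0; first by move=> y; apply/commr_sym/commr0.
apply: (@central_iterated_commutators n) => //.
have : commutators_in K n (P `&` K) x.
  have := normalized_commutators n sP nP Px; have := subnormal_commutators sK x0.
  by elim: n x {Px x0} => [//|m IH] x /= H1 H2 k Kk; apply: IH; [exact: H1|exact: H2].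
apply: commutators_in_sub => // y [Py Ky]; apply: contrapT => nZy.
by apply: nc; exists y.
Qed.

End InductionStep.
End Subnormal.

(** * Commutative division subrings normalized by a subnormal subgroup *)

Section OrbitPolynomial.
Variable D : unitRingType.
Hypothesis hD : division_ring D.
Implicit Types (x y z c h k a b d u w : D) (E F K L M P Q : set D).

Local Notation Z := (@ring_center D).

(** The polynomial whose roots are the [k^i c k^-i], for [i < j], has its
    coefficients in the subfield of [F] fixed by [k], and [c] is a root of it. *)
Lemma orbit_polynomial_dependent F k c j : div_subring F ->
  (forall x y, F x -> F y -> GRing.comm x y) ->
  (forall x, F x -> F (k * x * k^-1)) -> k != 0 -> F c -> (0 < j)%N ->
  GRing.comm c (k ^+ j) ->
  ~ left_independent (F `&` centralizer [set k]) c.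
Proof.
move=> sF Fcomm nF k0 Fc; case: j => [//|j] _ ckj.
pose ci i := k ^+ i * c * k ^- i.
have kX0 i : k ^+ i != 0 by exact: div_expf_neq0.
have ci0 : ci 0%N = c by rewrite /ci expr0 invr1 mulr1 mul1r.
have cij : ci j.+1 = c by rewrite /ci -ckj div_mulrK.
have ciS i : ci i.+1 = k * ci i * k^-1 by rewrite /ci exprS div_invMr // !mulrA.
have Fci i : F (ci i) by elim: i => [|i IH]; [rewrite ci0|rewrite ciS; exact: nF].
pose f m := \prod_(i < m) ('X - (ci i.+1)%:P).
pose g m := \prod_(i < m) ('X - (ci i)%:P).
(* conjugation by [k] shifts the roots, and [ci j.+1 = ci 0] *)
have kg m : k%:P * g m = f m * k%:P.
  elim: m => [|m IH]; first by rewrite /f /g !big_ord0 mulr1 mul1r.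
  rewrite /f /g !big_ord_recr /= -/(f m) -/(g m) mulrA IH -!mulrA; congr (_ * _).
  rewrite mulrBr mulrBl commr_polyX -!polyCM; congr (_ - _%:P).
  by rewrite ciS div_mulrVK.
have fg : f j.+1 = g j.+1.
  rewrite /f big_ord_recr /= cij /g big_ord_recl /= ci0.
  apply/commr_sym/commr_prod => i _; apply: commrB.
    exact: commr_polyX.
  apply/commr_sym/commrB; first exact: commr_polyX.
  by rewrite /GRing.comm -!polyCM; congr _%:P; exact: Fcomm.
have Ff m i : F (f m)`_i.
  elim: m i => [|m IH] i.
    rewrite /f big_ord0 coef1; case: (i == 0%N); [exact: subring1|exact: subring0].
  rewrite /f big_ord_recr /= -/(f m) mulrBr coefB coefMX coefMC.
  apply: subringB => //; last exact: subringM.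
  by case: (i == 0%N) => //; exact: subring0.
have fk i : GRing.comm (f j.+1)`_i k.
  have := kg j.+1; rewrite -fg => /(congr1 (fun p : {poly D} => p`_i)).
  by rewrite coefCM coefMC => /esym.
have fsize : size (f j.+1) = j.+2.
  by rewrite size_prod_XsubC -[index_enum _]enumT size_enum_ord.
move=> ind.
have fc : (f j.+1).[c] = 0.
  apply/eqP/factor_theorem; exists (f j).
  by rewrite [LHS]/f big_ord_recr /= cij.
have rel : \sum_(i < j.+2) (f j.+1)`_i * c ^+ i = 0 by rewrite -[RHS]fc horner_coef fsize.
have F0f i : (F `&` centralizer [set k]) (f j.+1)`_i.
  split; first exact: Ff.
  by move=> _ ->; exact: fk.
have f0 : (f j.+1)`_j.+1 = 0 by apply: (ind j.+2 _ F0f rel).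
have : lead_coef (f j.+1) = 1 by apply/eqP/monic_prod_XsubC.
by rewrite lead_coefE fsize /= f0 => /esym/eqP; rewrite oner_eq0.
Qed.

End OrbitPolynomial.

Section CommutativeNormalized.
Variable D : unitRingType.
Hypothesis hD : division_ring D.
Implicit Types (x y z c h k a b d u w : D) (E F K L M P Q : set D).

Local Notation Z := (@ring_center D).

Lemma subringI E F : div_subring E -> div_subring F -> div_subring (E `&` F).
Proof.
move=> [E1 EB EM EV] [F1 FB FM FV]; split=> // [x y|x y|x] [Ex Fx].
- by move=> [Ey Fy]; split; [exact: EB|exact: FB].
- by move=> [Ey Fy]; split; [exact: EM|exact: FM].
- by split; [exact: EV|exact: FV].
Qed.

Variables (n : nat) (K : set D).
Hypothesis sK : subnormal_depth n K.
Hypothesis CK : centralizer K `<=` Z.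

Let gK := subnormal_depth_subgroup hD sK.
Let K_neq0 k : K k -> k != 0. Proof. by case: gK => _ + _ _; apply. Qed.
Let KV k : K k -> K k^-1. Proof. by case: gK => _ _ _; apply. Qed.

(** Let [c] in [F :&: K] and [k] in [K] be noncommuting; then [k] is an
    eigenvector of [delta c], with a nonzero eigenvalue [q] in [F].  The
    indeterminate is [k] itself if its powers are independent over [F].
    Otherwise some [k^j] with [j > 0] centralizes [F], and it runs through the
    powers of [k^j] or through the subfield of [F] fixed by [k]; if both are
    finite, then [c] and [k] are torsion elements, contrary to
    [torsion_conj_eq]. *)
Lemma commutative_normalized_central F : div_subring F ->
  (forall x y, F x -> F y -> GRing.comm x y) -> normalized K F -> F `<=` Z.
Proof.
move=> sF Fcomm nF; apply: contrapT => nFZ.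
have [c [Fc Kc nZc]] := normalized_noncentral hD sK CK sF nF nFZ.
have [k Kk nck] : exists2 k, K k & ~ GRing.comm c k.
  apply: contrapT => nk; apply: nZc; apply: CK => k Kk.
  by apply: contrapT => nck; apply: nk; exists k.
have [c0 k0] : c != 0 /\ k != 0 by split; exact: K_neq0.
pose q := 1 - c * (k * c * k^-1)^-1.
have Fkc : F (k * c * k^-1) by exact: nF.
have Fq : F q by apply: subringB; [|exact: subring1|apply: subringM => //; exact: subringV].
have q0 : q != 0.
  have kc0 : k * c * k^-1 != 0 by apply: (div_mulf_neq0 hD); rewrite ?invr_eq0 //; exact: (div_mulf_neq0 hD).
  rewrite subr_eq0; apply/eqP => /(congr1 (fun x => x * (k * c * k^-1) * k)).
  by rewrite mul1r !div_mulrVK // => /esym.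
have dk : delta c k = q * k.
  rewrite /delta /q mulrBl mul1r; congr (_ - _).
  by rewrite !div_invMr ?invrK ?invr_eq0 ?(div_mulf_neq0 hD) // !mulrA div_mulrVK.
have dck m : iter m (delta c) k = q ^+ m * k.
  by apply: iter_delta_eigen => //; exact: Fcomm.
have qk0 m : q ^+ m * k != 0 by apply: div_mulf_neq0 => //; exact: div_expf_neq0.
have [ind|dep] := pselect (left_independent F k).
  have k1 : 1 + k != 0.
    apply/eqP => k1; apply: nck.
    have -> : k = - 1 by apply/eqP; rewrite -addr_eq0 addrC k1.
    exact: commrN1.
  have := skew_commutator_coef hD (m := n.+1) (a := 1) sF k0 _ _ ind Fc c0 (subring1 sF).
  rewrite mul1r dck iterS => H; have /eqP := qk0 n.+1; apply; apply: H.
  - by move=> e Fe; exact: nF.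
  - by move=> e Fe; rewrite -{2}(invrK k); apply: nF => //; exact: KV.
  - apply: (normalized_commut_l sF nF _ Fc).
    exact: (commutators_in_iter (subnormal_commutators sK k1) Kc).
have [m [e [Fe e0 em eC]]] := left_dependence hD sF k0 (fun e Fe => nF k e Kk Fe) dep.
have [j [j0 ckj]] : exists j, (0 < j)%N /\ forall x, F x -> GRing.comm x (k ^+ j).
  have [[j [jm ej]]|ne] := pselect (exists j, (j < m)%N /\ e j.+1 != 0).
    exists j.+1; split=> // x Fx; have := eC j.+1 x jm Fx.
    rewrite /GRing.comm mulrA (Fcomm x) // -!mulrA; exact: div_mulrI.
  case/eqP: (oner_neq0 D); rewrite -[RHS]em big1 ?addr0 // => j _.
  have [->|ej] := eqVneq (e j.+1) 0; first by rewrite mul0r.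
  by case: ne; exists j.
pose F0 : set D := F `&` centralizer [set k].
have sF0 : div_subring F0 by apply: subringI => //; exact: centralizer_div_subring.
have [t [t_inj tC ct kt]] : exists t : nat -> D, [/\ injective t,
    forall i j, GRing.comm (t i) (t j),
    forall i, GRing.comm c (t i) & forall i, GRing.comm k (t i)].
  have [F0fin|] := pselect (finite_set F0); last first.
    move=> /infinite_injection[t ti tF]; exists t; split=> // [i i'|i|i].
    - by apply: Fcomm; [case: (tF i)|case: (tF i')].
    - by apply: Fcomm => //; case: (tF i).
    - by apply/commr_sym; case: (tF i) => _; apply.
  have [p pD] : exists p, p \in [pchar D].
    apply: (char_of_finite hD F0fin) => i.
    elim: i => [|i IH]; first exact: subring0.
    by rewrite mulrS; apply: subringD => //; exact: subring1.
  have [kt|nkt] := pselect (torsion k); last first.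
    by apply: (not_torsion_powers hD k0 nkt j0); [exact: ckj|exact/commrX/commr_refl].
  have dep0 := orbit_polynomial_dependent hD sF Fcomm (fun e Fe => nF k e Kk Fe) k0 Fc j0 (ckj c Fc).
  have ct : torsion c.
    apply: (finite_dependent_torsion hD F0fin sF0 c0) => // e' [Fe' _].
    exact: Fcomm.
  case: nck; apply/commr_sym.
  apply: (torsion_conj_eq hD (prime_gt0 (pcharf_prime pD)) (pcharf0 pD)) => //.
  exact: Fcomm.
(* the commutator of an element of [K] with [c] is in [F], hence commutes with [c] *)
have := infinite_commuting_coef hD (m := n) (w := k) t_inj tC ct ct ct kt c0 c0 c0.
rewrite -!iterS dck => H; have /eqP := qk0 n.+2; apply; apply: H => i r0.
set r := iter n _ _.
have Kr : K r by exact: (commutators_in_iter (subnormal_commutators sK r0) Kc).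
apply/(gcommut_eq1 hD c0); first exact: (gcommut_neq0 hD _ (K_neq0 Kr)).
by apply: Fcomm => //; exact: (normalized_commut_l sF nF Kr Fc).
Qed.

End CommutativeNormalized.

(** * Unipotent conjugations *)

Section UnipotentConjugation.
Variable D : unitRingType.
Hypothesis hD : division_ring D.
Implicit Types (x y z c h k a b d u v w : D) (E F K L M P Q : set D).

Lemma delta_eq0 h w : h != 0 -> delta h w = 0 <-> GRing.comm h w.
Proof.
move=> h0; split=> [/eqP|hw].
  rewrite subr_eq0 => /eqP /(congr1 (fun x => x * h)).
  by rewrite div_mulrVK.
by rewrite /delta hw div_mulrK // subrr.
Qed.

Lemma subring_delta L h w : div_subring L -> L h -> L w -> L (delta h w).
Proof.
move=> sL Lh Lw; apply: subringB => //; apply: subringM => //; last exact: subringV.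
exact: subringM.
Qed.

(** If conjugation by [h] acts unipotently but not trivially, some element
    [y] satisfies [h y h^-1 = y - 1]. *)
Lemma unipotent_translation L h a N : div_subring L -> h != 0 -> L h -> L a ->
  iter N (delta h) a = 0 -> delta h a != 0 -> exists2 y, L y & delta h y = 1.
Proof.
move=> sL h0 Lh La aN ha.
have ex : exists m, iter m (delta h) a == 0 by exists N; rewrite aN.
case: (ex_minnP ex) => -[|[|m]] /eqP am mmin.
- by case/eqP: ha; rewrite -[a]/(iter 0 (delta h) a) am /delta mulr0 mul0r subrr.
- by case/eqP: ha.
have Lit j : L (iter j (delta h) a).
  by elim: j => [//|j IH]; rewrite iterS; exact: subring_delta.
set d := iter m (delta h) a; have Ld : L d by exact: Lit.
have c0 : delta h d != 0.
  by apply/negP => c0; have := mmin m.+1 c0; rewrite ltnn.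
have hc : GRing.comm h (delta h d) by apply/(delta_eq0 _ h0).
exists ((delta h d)^-1 * d); first by apply: subringM => //; apply: subringV => //; exact: (Lit m.+1).
rewrite -[RHS](div_mulVr hD c0) {1}/delta mulrA (commrV hc) -!mulrA -mulrBr.
by rewrite /delta mulrA.
Qed.

(** In this section [k y k^-1 = y - 1]. *)
Section Translation.
Variables (k y : D).
Hypotheses (k0 : k != 0) (ky : delta k y = 1).

Let kyE : k * y = (y - 1) * k.
Proof.
have <- : k * y * k^-1 = y - 1 by rewrite -ky /delta opprB addrC subrK.
by rewrite div_mulrVK.
Qed.

(** A Leibniz formula for [delta k]. *)
Lemma iter_delta_translation b j :
  iter j.+1 (delta k) (y * b) =
  j.+1%:R * iter j (delta k) b + (y - j.+1%:R) * iter j.+1 (delta k) b.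
Proof.
have dM w : delta k (y * w) = w + (y - 1) * delta k w.
  rewrite /delta mulrA kyE -!mulrA; set w' := k * _; non_commutative_ring.
have dD u w : delta k (u + w) = delta k u + delta k w.
  by rewrite /delta mulrDr mulrDl; non_commutative_ring.
have dn m w : delta k (m%:R * w) = m%:R * delta k w.
  by rewrite /delta mulrBr !mulrA (commr_nat k m).
elim: j => [|j IH]; first by rewrite /= dM mul1r.
rewrite iterS IH dD dn -iterS mulrBl dD -mulNr.
have -> : - j.+1%:R * iter j.+1 (delta k) b = j.+1%:R * (- iter j.+1 (delta k) b).
  by rewrite mulNr mulrN.
rewrite dn dM -iterS (_ : delta k (- _) = - iter j.+2 (delta k) b); last first.
  by rewrite /delta mulrN mulNr -opprD.
rewrite -[in RHS]natr1; set N := j.+1%:R; non_commutative_ring.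
Qed.

Lemma iter_delta_factorial m :
  iter m (delta k) (y ^+ m) = m`!%:R /\ iter m.+1 (delta k) (y ^+ m) = 0.
Proof.
elim: m => [|m [IH1 IH2]].
  by split; rewrite //= /delta mulr1 div_mulrV // subrr.
rewrite exprS !iter_delta_translation IH1 IH2 mulr0 addr0.
split; first by rewrite factS natrM.
have -> : iter m.+2 (delta k) (y ^+ m) = 0 by rewrite iterS IH2 /delta mulr0 mul0r subrr.
by rewrite !mulr0 addr0.
Qed.

Let B := centralizer (centralizer [set y]).

Let sB : div_subring B. Proof. exact: centralizer_div_subring. Qed.

Lemma bicentralizer_id : B y.
Proof. by move=> x Cx; apply/commr_sym/Cx. Qed.

Lemma bicentralizer_comm u v : B u -> B v -> GRing.comm u v.
Proof. by move=> Bu Bv; apply: Bu => _ ->; apply: Bv => _ ->; exact: commr_refl. Qed.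

Lemma bicentralizer_gcommut u : B u -> B (gcommut k u).
Proof.
have conjC x : centralizer [set y] x -> centralizer [set y] (k^-1 * x * k).
  move=> Cx _ ->; have xy := Cx _ erefl; apply: (div_mulrI hD k0).
  have xy1 : GRing.comm x (y - 1) by apply: commrB => //; exact: commr1.
  rewrite -!mulrA div_mulVKr // (mulrA k y) kyE -[in RHS]mulrA div_mulVKr //.
  by rewrite mulrA xy1 mulrA.
have nB v : B v -> B (k * v * k^-1).
  move=> Bv x /conjC/Bv /(congr1 (fun w => k * w * k^-1)).
  by rewrite /GRing.comm !mulrA div_mulrK // div_mulrV // mul1r.
move=> Bu; rewrite /gcommut -!mulrA (mulrA k); apply: (subringM sB Bu).
exact: (nB _ (subringV sB Bu)).
Qed.

(** In positive characteristic conjugation by [k] has finite order on the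
    elements that commute with all that commutes with [y], so that it cannot act
    unipotently on their multiplicative group without fixing [y]. *)
Lemma iter_gcommut_translation p m : p \in [pchar D] -> y != 0 ->
  iter m.+1 (gcommut k) y != 1.
Proof.
move=> pD y0.
have kX j : k ^+ j * y = (y - j%:R) * k ^+ j.
  elim: j => [|j IH]; first by rewrite !expr0 subr0 mulr1 mul1r.
  rewrite exprS -mulrA IH mulrA mulrBr kyE (commr_nat k j) -mulrBl -mulrA.
  by congr (_ * _); rewrite -natr1; non_commutative_ring.
have kpB u : B u -> GRing.comm u (k ^+ p).
  by apply=> _ ->; rewrite /GRing.comm kX (pcharf0 pD) subr0.
have BN0 u : u != 0 -> gcommut k u != 0 by move=> u0; exact: gcommut_neq0.
have descent u : B u -> u != 0 -> gcommut k (gcommut k u) = 1 -> gcommut k u = 1.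
  move=> Bu u0; have v0 := BN0 u u0; have Bv := bicentralizer_gcommut Bu.
  have : u * k = gcommut k u * (k * u).
    by rewrite /gcommut -!mulrA div_mulKr // div_mulVr // mulr1.
  move: (gcommut k u) v0 Bv => v v0 Bv uk /(gcommut_eq1 hD k0 v0) vk.
  have ukX j : u * k ^+ j = v ^+ j * (k ^+ j * u).
    elim: j => [|j IH]; first by rewrite !expr0 !mulr1 !mul1r.
    rewrite exprSr mulrA IH -!mulrA uk exprSr -!mulrA; congr (_ * _).
    by rewrite !mulrA (commrX j vk).
  apply: (pchar_expr_eq1 hD pD); apply: (div_mulIr hD (div_expf_neq0 hD p k0)).
  apply: (div_mulIr hD u0); rewrite -mulrA -ukX mul1r; exact: kpB.
have Bit j : B (iter j (gcommut k) y) /\ iter j (gcommut k) y != 0.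
  elim: j => [|j [IH1 IH2]]; first by split=> //; exact: bicentralizer_id.
  by rewrite iterS; split; [exact: bicentralizer_gcommut|exact: BN0].
elim: m => [|m IH]; apply/eqP.
  move=> /(gcommut_eq1 hD k0 y0) /commr_sym/(delta_eq0 _ k0) /eqP.
  by rewrite ky oner_eq0.
move=> e; case/eqP: IH; rewrite iterS; apply: descent; first by case: (Bit m).
  by case: (Bit m).
exact: e.
Qed.

End Translation.
End UnipotentConjugation.

(** * Centralizers of subnormal subgroups *)

(** [M] is noncentral and normalized by [K]; its centralizer [L] and the
    bicentralizer [L'] are both normalized by [K]. *)
Section CentralizerStep.
Variable D : unitRingType.
Hypothesis hD : division_ring D.
Implicit Types (x y z c h k a b d u w : D) (E F K L M P Q : set D).

Local Notation Z := (@ring_center D).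

Variables (n : nat) (K M : set D).
Hypothesis sK : subnormal_depth n K.
Hypothesis CK : centralizer K `<=` Z.
Hypothesis nM : forall k m, K k -> M m -> M (k * m * k^-1).
Hypothesis MZ : ~ M `<=` Z.

Let gK := subnormal_depth_subgroup hD sK.
Let K_neq0 k : K k -> k != 0. Proof. by case: gK => _ + _ _; apply. Qed.
Let KV k : K k -> K k^-1. Proof. by case: gK => _ _ _; apply. Qed.

Let L := centralizer M.
Let L' := centralizer L.
Let sL : div_subring L. Proof. exact: centralizer_div_subring. Qed.
Let sL' : div_subring L'. Proof. exact: centralizer_div_subring. Qed.
Let nL : normalized K L. Proof. exact: centralizer_normalized. Qed.
Let nL' : normalized K L'. Proof. exact: centralizer_normalized. Qed.

Let ML' : M `<=` L'. Proof. by move=> m Mm l Ll; apply/commr_sym/Ll. Qed.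

Let LL'Z : L `&` L' `<=` Z.
Proof.
apply: (commutative_normalized_central hD sK CK (subringI sL sL')).
- by move=> x y [_ L'x] [Ly _]; exact: L'x.
- by move=> k x Kk [Lx L'x]; split; [exact: nL|exact: nL'].
Qed.

Let noncomm : exists b d, [/\ L' b, L' d & ~ GRing.comm b d].
Proof.
apply: contrapT => nex; apply: MZ => m Mm.
apply: LL'Z; split; last exact: ML'.
move=> m' Mm'; apply: contrapT => mm'; apply: nex; exists m, m'.
by split=> //; exact: ML'.
Qed.

(** The elements of [L] lying in [K] act unipotently on [L] by conjugation.  The
    commutators [[1 + w, h, .., h]] of length [n + 1] are in [L].  If [Z] is
    infinite, take [w = a b t] with [t] in [Z] and [b] in [L'], and use that the
    elements of [L] commute with a [d] in [L'] that does not commute with [b].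
    If [Z] is finite, take [w = a c] for an element [c] of infinite order of
    [L'], whose powers are independent over [L]. *)
Lemma centralizer_unipotent h a : L h -> K h -> L a -> iter n.+1 (delta h) a = 0.
Proof.
move=> Lh Kh La; have h0 := K_neq0 Kh.
have Lit m x : L x -> L (iter m (delta h) x).
  by move=> Lx; elim: m => [//|m IH]; rewrite iterS; exact: (subring_delta sL Lh IH).
have [b [d [L'b L'd nbd]]] := noncomm.
have word w : 1 + w != 0 -> L (gcommut h (iter n (gcommut h) (1 + w))).
  move=> w0; apply: (normalized_commut_l sL nL _ Lh).
  exact: (commutators_in_iter (subnormal_commutators sK w0) Kh).
have Kword w : 1 + w != 0 -> iter n (gcommut h) (1 + w) != 0.
  move=> w0; apply: K_neq0.
  exact: (commutators_in_iter (subnormal_commutators sK w0) Kh).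
have d0 : d != 0 by apply: contra_notN nbd => /eqP ->; exact: commr0.
have bdV : b - d * b * d^-1 != 0.
  rewrite subr_eq0; apply: contra_notN nbd => /eqP bd.
  by rewrite /GRing.comm {1}bd div_mulrVK.
have [Zfin|] := pselect (finite_set Z); last first.
  move=> /infinite_injection[t t_inj tZ].
  have tC x i : GRing.comm x (t i) by apply/commr_sym; exact: tZ.
  have := infinite_commuting_coef hD (m := n) (w := a * b) t_inj (fun i j => tC _ j)
    (tC h) (tC h) (tC d) (tC _) h0 h0 d0.
  rewrite -iterS iter_deltaMr //; last by apply/commr_sym; exact: L'b.
  have La' := Lit n.+1 a La; move: (iter n.+1 (delta h) a) La' => a' La' H.
  have /eqP : a' * (b - d * b * d^-1) = 0.
    rewrite -[RHS]H.
      rewrite /delta mulrBr; congr (_ - _).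
      by rewrite !mulrA (L'd _ La').
    move=> i r0; apply/(gcommut_eq1 hD d0); first exact: (gcommut_neq0 hD h0 (Kword _ r0)).
    exact/commr_sym/L'd/word.
  apply: contraTeq => a'0; exact: div_mulf_neq0.
have sZ := center_div_subring D.
have [p pD] : exists p, p \in [pchar D].
  by apply: (char_of_finite hD Zfin) => i y; exact/commr_sym/commr_nat.
have [c [L'c c0 nct]] : exists c, [/\ L' c, c != 0 & ~ torsion c].
  apply: contrapT => nex; apply: nbd.
  apply: (torsion_division_comm hD pD sL') => // x L'x x0.
  by apply: contrapT => nxt; apply: nex; exists x.
have nLc : ~ L c.
  move=> Lc; apply: nct; apply: (finite_powers_torsion hD Zfin c0) => i.
  by apply: (subringX sZ); exact: LL'Z.
have cConj e : GRing.comm c e -> c * e * c^-1 = e by move=> ce; rewrite ce div_mulrK.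
have ind : left_independent L c.
  apply: contrapT => dep.
  (* a minimal relation has its coefficients in the finite center *)
  have [|m [e [Le e0 em eC]]] := left_dependence hD sL c0 _ dep.
    by move=> e Le; rewrite cConj //; exact: L'c.
  apply: nct; apply: (finite_dependent_torsion hD Zfin sZ c0) => [e' Ze'|indZ]; first exact: Ze'.
  have Ze j : (j <= m)%N -> Z (e j).
    move=> jm; apply: LL'Z; split=> // l Ll.
    have cl : GRing.comm (c ^+ j) l by apply/commr_sym/commrX/commr_sym/L'c.
    apply: (div_mulIr hD (div_expf_neq0 hD j c0)).
    by rewrite -mulrA -cl mulrA -(eC j l jm Ll) mulrA.
  pose e' j := if (j <= m)%N then e j else 0.
  have Ze' j : Z (e' j).
    by rewrite /e'; case: ifP => [|_]; [exact: Ze|exact: subring0].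
  have e'0 : e' 0%N = 0.
    apply: (indZ m.+1 e' Ze') => //.
    rewrite big_ord_recl /e' leq0n e0 mul1r expr0 -[RHS]em; congr (_ + _).
    by apply: eq_bigr => j _; rewrite lift0 ltn_ord.
  by move/eqP: e'0; rewrite /e' e0 oner_eq0.
have ac0 : 1 + a * c != 0.
  apply/eqP => ac; apply: nLc.
  have ac1 : a * (- c) = 1 by apply/eqP; rewrite mulrN eq_sym -addr_eq0 ac.
  have a0 : a != 0.
    by apply: contra_eq_neq ac1 => ->; rewrite mul0r eq_sym oner_neq0.
  have -> : c = - a^-1.
    by apply: (div_mulrI hD a0); rewrite mulrN div_mulrV // -ac1 mulrN opprK.
  exact: (subringN sL (subringV sL La)).
have := skew_commutator_coef hD (m := n.+1) (a := a) sL c0 _ _ ind Lh h0 La.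
rewrite iter_deltaMr //; last by apply/commr_sym/L'c.
move=> H; apply/eqP; have /eqP : iter n.+1 (delta h) a * c = 0.
  apply: H.
  - by move=> e Le; rewrite cConj //; exact: L'c.
  - by move=> e Le; rewrite (commr_inv (L'c _ Le)) div_mulrVK.
  - by rewrite iterS; exact: word.
by apply: contraTT => a'0; exact: div_mulf_neq0.
Qed.

Lemma centralizer_step : centralizer M `<=` Z.
Proof.
apply: contrapT => nLZ.
have [k [Lk Kk nZk]] := normalized_noncentral hD sK CK sL nL nLZ.
have k0 := K_neq0 Kk.
have [a La nka] : exists2 a, L a & ~ GRing.comm k a.
  apply: contrapT => nex; apply: nZk; apply: LL'Z; split=> // l Ll.
  by apply: contrapT => nkl; apply: nex; exists l.
have [y Ly ky] := unipotent_translation hD sL k0 Lk La (centralizer_unipotent Lk Kk La)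
  (introN eqP (contra_not (proj1 (delta_eq0 hD a k0)) nka)).
have y0 : y != 0.
  by apply: contra_eq_neq ky => ->; rewrite /delta mulr0 mul0r subrr eq_sym oner_neq0.
have [[p pD]|npD] := pselect (exists p, p \in [pchar D]); last first.
  have := centralizer_unipotent Lk Kk (subringX sL n.+1 Ly).
  rewrite (proj1 (iter_delta_factorial hD k0 ky n.+1)) => f0; apply: npD.
  exact: (pchar_exists hD (fact_gt0 _) f0).
set u := iter n (gcommut k) y.
have Ku : K u by exact: (commutators_in_iter (subnormal_commutators sK y0) Kk).
have Lu : L u.
  rewrite /u; elim: (n) => [//|m IH]; rewrite iterS; exact: (normalized_commut sL nL Kk IH).
have u0 := K_neq0 Ku.
have := iter_gcommut_translation hD k0 ky n pD y0.
rewrite iterS -/u => v1.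
have Bu : centralizer (centralizer [set y]) u.
  rewrite /u; elim: (n) => [|m IH]; first exact: bicentralizer_id.
  by rewrite iterS; exact: (bicentralizer_gcommut hD k0 ky IH).
have uv : GRing.comm u (1 - gcommut k u).
  apply: commrB; first exact: commr1.
  exact: (bicentralizer_comm Bu (bicentralizer_gcommut hD k0 ky Bu)).
have dk : delta u k = (1 - gcommut k u) * k.
  by rewrite /delta mulrBl mul1r /gcommut div_mulrVK.
have := centralizer_unipotent Lu Ku Lk.
rewrite (iter_delta_eigen n.+1 u0 uv dk) => /eqP; apply/negP.
apply: (div_mulf_neq0 hD) => //; apply: (div_expf_neq0 hD).
by rewrite subr_eq0 eq_sym.
Qed.

End CentralizerStep.

Section Consequences.
Variable D : unitRingType.
Hypothesis hD : division_ring D.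
Implicit Types (x y z c h k a b d u w : D) (E F K L M P Q : set D).

Local Notation Z := (@ring_center D).

(** A noncentral subnormal subgroup has only central elements in its centralizer. *)
Lemma centralizer_subnormal n M : subnormal_depth n M -> ~ M `<=` Z ->
  centralizer M `<=` Z.
Proof.
elim: n M => [|n IH] M.
  move=> -> _ x Cx y; have [->|y0] := eqVneq y 0; first exact: commr0.
  exact: Cx.
move=> [K [sK _ MK nM]] MZ.
have CK : centralizer K `<=` Z by apply: (IH K sK) => KZ; apply: MZ => m /MK/KZ.
exact: (centralizer_step hD sK CK nM MZ).
Qed.

Lemma subnormal_central_commutators n M m x : subnormal_depth n M -> ~ M `<=` Z ->
  x != 0 -> commutators_in M m Z x -> Z x.
Proof.
move=> sM MZ; exact: (central_iterated_commutators hD sM (centralizer_subnormal sM MZ)).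
Qed.

(** [K] is covered by finitely many cosets of [Z]. *)
Definition finite_mod_center K :=
  exists s : seq D, forall x, K x -> exists y z, [/\ y \in s, Z z & x = y * z].

(** It suffices to map [K] to a finite type so that elements with the same image
    are congruent modulo [Z]. *)
Lemma finite_mod_center_map (T : finType) K (f : D -> T) : mult_subgroup K ->
  (forall x y, K x -> K y -> f x = f y -> Z (y^-1 * x)) -> finite_mod_center K.
Proof.
move=> [_ K0 _ _] fK.
pose r t := if pselect (exists2 x, K x & f x = t) is left e then sval (cid2 e) else 0.
exists (map r (enum T)) => x Kx.
have [Kr fr] : K (r (f x)) /\ f (r (f x)) = f x.
  rewrite /r; case: pselect => [e|ne]; first by case: (cid2 e).
  by case: ne; exists x.
exists (r (f x)), ((r (f x))^-1 * x); split.
- by apply/mapP; exists (f x); rewrite ?mem_enum.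
- exact: fK.
- by rewrite div_mulVKr //; exact: K0.
Qed.

(** If [M] is finite modulo [Z] and normal in [K], then an element of [K] is
    determined modulo [Z] by the way in which it permutes the cosets of [Z] in
    [M], so that [K] is finite modulo [Z] as well; and [D^*] is not. *)
Lemma subnormal_not_finite_mod_center n M : subnormal_depth n M -> ~ M `<=` Z ->
  ~ finite_mod_center M.
Proof.
elim: n M => [|n IH] M.
  move=> -> MZ [s fs].
  have [a Za] : exists a, ~ Z a.
    by apply: contrapT => nex; apply: MZ => x _; apply: contrapT => nx; apply: nex; exists x.
  have [Zfin|] := pselect (finite_set Z).
    have sZ := center_div_subring D.
    have [p pD] : exists p, p \in [pchar D].
      by apply: (char_of_finite hD Zfin) => i y; exact/commr_sym/commr_nat.
    have Dfin : finite_set (setT : set D).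
      have sfin : finite_set [set` s] by exact: finite_seq.
      have Z0 : Z 0 by exact: subring0.
      apply: (@sub_finite_set _ _ ((0%R |` [set y * z | y in [set` s] & z in Z]))); last first.
        by rewrite finite_setU; split; [exact: finite_set1|exact: finite_image2].
      move=> x _; have [->|x0] := eqVneq x 0; first by left.
      right; have [y [z [ys Zz ->]]] := fs x x0; exists y => //; exists z => //.
    have sT : div_subring (setT : set D) by [].
    by apply: Za => y; exact: (finite_division_comm hD sT Dfin).
  move=> /infinite_injection[t t_inj tZ].
  have sZ := center_div_subring D.
  have at0 i : a + t i != 0.
    apply/eqP => ati; apply: Za.
    have -> : a = - t i by apply/eqP; rewrite -addr_eq0 ati.
    exact: (subringN sZ).
  (* two of the [a + t i] lie in the same coset of [Z], which makes [a] central *)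
  have /choice[y yP] : forall i, exists y, y \in s /\ exists2 z, Z z & a + t i = y * z.
    by move=> i; have [y [z [ys Zz e]]] := fs _ (at0 i); exists y; split=> //; exists z.
  have [i [j [ij yij]]] := pigeonhole (finite_seq s) (fun i => proj1 (yP i)).
  have [_ [zi Zzi ei]] := yP i; have [_ [zj Zzj ej]] := yP j.
  have zi0 : zi != 0 by apply: contra_neq (at0 i) => zi0; rewrite ei zi0 mulr0.
  pose z := zi^-1 * zj.
  have Zz : Z z by apply: (subringM sZ) => //; exact: (subringV sZ).
  have eij : a + t j = (a + t i) * z by rewrite ei ej yij /z -mulrA div_mulVKr.
  have [z1|z1] := eqVneq z 1.
    move: eij; rewrite z1 mulr1 => /addrI/t_inj ji.
    by rewrite ji ltnn in ij.
  have z1' : 1 - z != 0 by rewrite subr_eq0 eq_sym.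
  apply: Za; have -> : a = (t i * z - t j) * (1 - z)^-1.
    apply: (div_mulIr hD z1'); rewrite div_mulrVK // mulrBr mulr1.
    have -> : a = (a + t i) * z - t j by rewrite -eij addrK.
    have -> : (a + t i) * z - t j - ((a + t i) * z - t j) * z
      = t i * z - t j + (a * z - ((a + t i) * z - t j) * z) by non_commutative_ring.
    by rewrite -eij addrK subrr addr0.
  apply: (subringM sZ); first by apply: (subringB sZ) => //; exact: (subringM sZ).
  by apply: (subringV sZ); apply: (subringB sZ) => //; exact: (subring1 sZ).
move=> sM; have [K [sK gM MK nM]] := sM; move=> MZ [s fs].
have sZ := center_div_subring D.
have gK := subnormal_depth_subgroup hD sK; have [_ K0 KM KV] := gK.
have [_ M0 _ _] := gM.
apply: (IH K sK) => [KZ|]; first by apply: MZ => m /MK/KZ.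
(* [x] conjugates the coset of [s`_i] to that of [s`_j] *)
pose same x (i j : 'I_(size s)) := `[< exists2 z, Z z & x * s`_i * x^-1 = s`_j * z >].
apply: (@finite_mod_center_map {ffun 'I_(size s) -> option 'I_(size s)} K
  (fun x => [ffun i => [pick j | same x i j]]) gK) => x y Kx Ky fxy.
have [x0 y0] := (K0 x Kx, K0 y Ky).
have w0 : y^-1 * x != 0 by apply: (div_mulf_neq0 hD); rewrite ?invr_eq0.
apply: (@subnormal_central_commutators n.+1 M 1 _ sM MZ w0) => m Mm.
have m0 := M0 _ Mm.
have [_ [z [/(nthP 0)[i si <-] Zz mE]]] := fs m Mm.
have [si0 z0] : s`_i != 0 /\ z != 0.
  split; first by apply: contra_neq m0; rewrite mE => ->; rewrite mul0r.
  by apply: contra_neq m0; rewrite mE => ->; rewrite mulr0.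
have [j] : exists j, same x (Ordinal si) j.
  have [_ [z' [/(nthP 0)[j sj <-] Zz' e]]] := fs _ (nM x m Kx Mm).
  exists (Ordinal sj); apply/asboolP; exists (z' * z^-1).
    by apply: (subringM sZ) => //; exact: (subringV sZ).
  rewrite mulrA -e mE /= !mulrA.
  have zV : GRing.comm z^-1 x^-1 by apply/commrV/commr_inv/Zz.
  by rewrite -!mulrA -zV div_mulVKr.
move: (congr1 (fun g : {ffun _} => g (Ordinal si)) fxy); rewrite !ffunE.
case: pickP => [j1 /asboolP[z1 Zz1 /= e1]|/(_ j) -> //] /esym.
case: pickP => [j2 /asboolP[z2 Zz2 /= e2] [ej] _|//]; rewrite ej in e2.
have z20 : z2 != 0.
  have : y * s`_i * y^-1 != 0.
    by apply: (div_mulf_neq0 hD); rewrite ?invr_eq0 //; exact: (div_mulf_neq0 hD).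
  by rewrite e2; apply: contra_neq => ->; rewrite mulr0.
have -> : gcommut m (y^-1 * x) = z2^-1 * z1.
  have Zz12 : Z (z2^-1 * z1) by apply: (subringM sZ) => //; exact: (subringV sZ).
  rewrite /gcommut; apply: (div_mulIr hD m0); rewrite div_mulrVK //.
  have sjE : s`_j1 = y * s`_i * y^-1 * z2^-1.
    by rewrite e2; apply: (div_mulIr hD z20); rewrite div_mulrVK.
  rewrite div_invMr ?invr_eq0 // invrK mE.
  have -> : y^-1 * x * (s`_i * z) * (x^-1 * y) = y^-1 * (x * s`_i * x^-1) * y * z.
    rewrite -!mulrA; do 3 congr (_ * _).
    by rewrite !mulrA (Zz x^-1) -!mulrA (Zz y).
  rewrite e1 sjE.
  have -> : y^-1 * (y * s`_i * y^-1 * z2^-1 * z1) * y * z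
    = y^-1 * (y * (s`_i * (y^-1 * ((z2^-1 * z1) * y)))) * z by rewrite !mulrA.
  by rewrite div_mulKr // (Zz12 y) div_mulKr // -(Zz12 s`_i) mulrA.
exact: (subringM sZ (subringV sZ Zz2) Zz1).
Qed.

End Consequences.

(** * Subnormal subgroups inside almost subnormal ones *)

Section UnitGroupSubgroups.
Variable D : unitRingType.
Hypothesis hD : division_ring D.
Implicit Types (x y z m h a : D) (M : set D) (H K N : set (unit_group D)).

Local Notation Z := (@ring_center D).

(** The unit with a given nonzero value. *)
Definition to_unit x : unit_group D := insubd (1%g : unit_group D) x.

Lemma to_unitK x : x != 0 -> val (to_unit x) = x.
Proof. by move=> /hD ux; rewrite insubdK. Qed.

Lemma unit_neq0 (u : unit_group D) : val u != 0.
Proof. by apply: contraTneq (valP u) => ->; rewrite unitr0. Qed.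

Lemma val_unitK (u : unit_group D) : to_unit (val u) = u.
Proof. by apply: val_inj; rewrite to_unitK ?unit_neq0. Qed.

Lemma to_unitM x y : x != 0 -> y != 0 -> to_unit (x * y) = (to_unit x * to_unit y)%g.
Proof.
by move=> x0 y0; apply: val_inj; rewrite /= !to_unitK //; exact: (div_mulf_neq0 hD).
Qed.

Lemma to_unitV x : x != 0 -> to_unit x^-1 = (to_unit x)^-1%g.
Proof. by move=> x0; apply: val_inj; rewrite /= !to_unitK ?invr_eq0. Qed.

Lemma to_unit1 : to_unit 1 = 1%g.
Proof. by apply: val_inj; rewrite to_unitK ?oner_neq0. Qed.

Lemma to_unit_conj x h : x != 0 -> h != 0 ->
  to_unit (h * x * h^-1) = ((to_unit x) ^ (to_unit h)^-1)%g.
Proof.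
move=> x0 h0; have hV0 : h^-1 != 0 by rewrite invr_eq0.
rewrite to_unitM ?(div_mulf_neq0 hD) // to_unitM // to_unitV //.
by rewrite conjgE invgK mulgA.
Qed.

(** A set of units as a set of elements of [D], and conversely. *)
Definition unit_values N : set D := [set x | x != 0 /\ N (to_unit x)].
Definition units_in M : set (unit_group D) := [set u | M (val u)].

Lemma units_in_subgroup M : mult_subgroup M -> is_subgroup (units_in M).
Proof.
move=> [M1 M0 MM MV]; split=> [|u v|u]; first exact: M1.
- exact: MM.
- exact: MV.
Qed.

Lemma subnormal_extend (G : groupType) (N H : set G) : subnormal H -> is_subgroup N ->
  N `<=` H -> normal_in N H -> subnormal N.
Proof.
move=> [r [C [C0 Cr Csub Cstep]]] sN NH nN.
exists r.+1, (fun i => if (i <= r)%N then C i else N); split=> [|| i ir|i ir].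
- by rewrite leq0n.
- by rewrite ltnn.
- by case: ifP => [|_ //]; exact: Csub.
- rewrite ltnS in ir; rewrite ir; case: ifP => ir'; first exact: Cstep.
  have -> : i = r by apply/eqP; rewrite eqn_leq ir leqNgt ir'.
  by rewrite Cr.
Qed.

Lemma subnormal_units_in n M : subnormal_depth n M -> subnormal (units_in M).
Proof.
elim: n M => [|n IH] M.
  move=> ->; have -> : units_in [set x | x != 0] = setT.
    by apply/seteqP; split=> // u _; exact: unit_neq0.
  by exists 0%N, (fun=> setT); split.
move=> [H [sH gM MH nM]]; apply: (subnormal_extend (IH H sH)).
- exact: units_in_subgroup.
- by move=> u /MH.
- move=> u h Mu Hh; have [_ _ _ HV] := subnormal_depth_subgroup hD sH.
  have := nM _ _ (HV _ Hh) Mu; rewrite invrK conjgE -mulrA.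
  exact.
Qed.

Lemma left_coset_eq (G : groupType) (K : set G) (x y : G) : is_subgroup K ->
  left_coset K x = left_coset K y -> K (y^-1 * x)%g.
Proof.
move=> [K1 _ _] xy; have : left_coset K y x by rewrite -xy; exists 1%g => //; rewrite mulg1.
by move=> [k Kk <-]; rewrite mulKg.
Qed.

Lemma left_cosetM (G : groupType) (K : set G) (m x : G) :
  left_coset K (m * x)%g = [set (m * u)%g | u in left_coset K x].
Proof.
apply/seteqP; split=> [_ [k Kk <-]|_ [_ [k Kk <-] <-]].
  by exists (x * k)%g; [exists k|rewrite mulgA].
by exists k => //; rewrite mulgA.
Qed.

Lemma unit_values_subgroup N : is_subgroup N -> mult_subgroup (unit_values N).
Proof.
move=> [N1 NM NV]; split=> [|x []//|x y [x0 Nx] [y0 Ny]|x [x0 Nx]].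
- by split; [exact: oner_neq0|rewrite to_unit1].
- by split; [exact: (div_mulf_neq0 hD)|rewrite to_unitM //; exact: NM].
- by split; [rewrite invr_eq0|rewrite to_unitV //; exact: NV].
Qed.

(** One step of the construction: [H] and [N] are consecutive terms of the chain,
    and [M] is a noncentral subnormal subgroup contained in [H]. *)
Section ChainStep.
Variables (n : nat) (M : set D) (H N : set (unit_group D)).
Hypothesis sM : subnormal_depth n M.
Hypothesis MZ : ~ M `<=` Z.
Hypothesis MH : M `<=` unit_values H.
Hypotheses (gH : is_subgroup H) (gN : is_subgroup N).

Let gM := subnormal_depth_subgroup hD sM.
Let M_neq0 x : M x -> x != 0. Proof. by case: gM => _ + _ _; apply. Qed.

(** The commutators [[a, m_1, .., m_n]] with the [m_i] in [M] belong to [M] because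
    [M] has depth [n], and to [N] because [N] is normal in [H]. *)
Lemma chain_step_normal a : normal_in N H -> unit_values N a -> ~ Z a ->
  exists M', [/\ subnormal_depth n.+1 M', M' `<=` unit_values N & ~ M' `<=` Z].
Proof.
move=> nN Na nZa; have [a0 _] := Na.
have [M1 _ MM MV] := gM.
have [N1 N0 NM NV] := unit_values_subgroup gN.
have conjN h x : M h -> unit_values N x -> unit_values N (h * x * h^-1).
  move=> Mh [x0 Nx]; have h0 := M_neq0 Mh.
  have hV0 : h^-1 != 0 by rewrite invr_eq0.
  split; first by do 2?[apply: (div_mulf_neq0 hD) => //].
  rewrite to_unit_conj //; apply: nN => //.
  by case: gH => _ _; apply; case: (MH Mh).
exists (M `&` unit_values N); split.
- exists M; split; [exact: sM| |by move=> x []|]; last first.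
    move=> h x Mh [Mx Nx]; split; last exact: conjN.
    by apply: (MM); [exact: MM|exact: MV].
  split; [by []|by move=> x [/M_neq0]| |].
  - by move=> x y [Mx Nx] [My Ny]; split; [exact: MM|exact: NM].
  - by move=> x [Mx Nx]; split; [exact: MV|exact: NV].
- by move=> x [].
move=> MNZ; apply: nZa; apply: (subnormal_central_commutators hD sM MZ (m := n) a0).
apply: (commutators_in_sub (fun _ => id) MNZ).
have := subnormal_commutators sM a0.
elim: (n) a a0 Na => [|j IH] x x0 Nx /=; first by move=> Mx.
move=> Mw m Mm; apply: IH (Mw m Mm); first exact: (gcommut_neq0 hD (M_neq0 Mm)).
rewrite /gcommut -!mulrA (mulrA m); apply: (NM) => //.
by apply: conjN => //; exact: NV.
Qed.

(** The core of [N] in [M] is the kernel of the action of [M] on the finite set of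
    left cosets of [N] in [H]; if it were central, [M] would be finite modulo
    [Z]. *)
Lemma chain_step_finite_index : finite_index N H ->
  exists M', [/\ subnormal_depth n.+1 M', M' `<=` unit_values N & ~ M' `<=` Z].
Proof.
move=> fN.
have [M1 _ MM MV] := gM.
have [N1 N0 NM NV] := unit_values_subgroup gN.
pose M' : set D := [set m | M m /\ forall x, M x -> unit_values N (x * m * x^-1)].
have gM' : mult_subgroup M'.
  split=> [|m [Mm _]|m m' [Mm Nm] [Mm' Nm']|m [Mm Nm]].
  - by split=> // x Mx; rewrite mulr1 div_mulrV //; exact: M_neq0.
  - exact: M_neq0.
  - split=> [|x Mx]; first exact: MM.
    have -> : x * (m * m') * x^-1 = (x * m * x^-1) * (x * m' * x^-1).
      by rewrite !mulrA div_mulrVK //; exact: M_neq0.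
    by apply: (NM); [exact: Nm|exact: Nm'].
  - split=> [|x Mx]; first exact: MV.
    have x0 := M_neq0 Mx; have m0 := M_neq0 Mm.
    have := NV _ (Nm x Mx).
    by rewrite !div_invMr ?invrK ?invr_eq0 ?(div_mulf_neq0 hD) // mulrA.
exists M'; split.
- exists M; split; [exact: sM|exact: gM'|by move=> m []|].
  move=> h m Mh [Mm Nm]; split=> [|x Mx].
    by apply: (MM); [exact: MM|exact: MV].
  have -> : x * (h * m * h^-1) * x^-1 = (x * h) * m * (x * h)^-1.
    by rewrite div_invMr ?(M_neq0 Mx) ?(M_neq0 Mh) // !mulrA.
  exact/Nm/MM.
- move=> m [Mm /(_ 1 M1)]; by rewrite mul1r invr1 mulr1.
move=> M'Z; apply: (subnormal_not_finite_mod_center hD sM MZ).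
have [q /card_set_bijP[phi [phi_fun phi_inj _]]] := fN.
(* a representative in [H] of the coset numbered [j] *)
pose r (j : 'I_q) : unit_group D :=
  if pselect (exists2 u, H u & phi (left_coset N u) = j) is left e
  then sval (cid2 e) else 1%g.
have q_gt0 : (0 < q)%N.
  have [H1 _ _] := gH.
  have /phi_fun : [set left_coset N x | x in H] (left_coset N 1%g) by exists 1%g.
  by apply: leq_ltn_trans.
have rE u : H u -> exists j, left_coset N (r j) = left_coset N u.
  move=> Hu; have uq : (phi (left_coset N u) < q)%N by apply: phi_fun; exists u.
  exists (Ordinal uq); rewrite /r; case: pselect => [e|ne]; last first.
    by case: ne; exists u.
  case: (cid2 e) => v Hv /= pv; apply: phi_inj; rewrite ?inE //.
  - by exists v.
  - by exists u.
have rH j : H (r j).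
  rewrite /r; case: pselect => [e|_]; last by case: gH.
  by case: (cid2 e).
have [_ HM HV] := gH.
have phi_lt u : H u -> (phi (left_coset N u) < q)%N.
  by move=> Hu; apply: phi_fun; exists u.
pose act x : {ffun 'I_q -> 'I_q} :=
  [ffun j => insubd j (phi (left_coset N (to_unit x * r j)%g))].
apply: (finite_mod_center_map hD (f := act) gM) => x y Mx My xy.
have [x0 y0] := (M_neq0 Mx, M_neq0 My).
apply: M'Z; split=> [|m Mm]; first by apply: MM => //; exact: MV.
have m0 := M_neq0 Mm.
have [Hx Hy] : H (to_unit x) /\ H (to_unit y) by split; [case: (MH Mx)|case: (MH My)].
have HmV : H (to_unit m^-1) by rewrite to_unitV //; apply: HV; case: (MH Mm).
have [j rj] := rE _ HmV.
have := congr1 (fun g : {ffun 'I_q -> 'I_q} => val (g j)) xy.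
rewrite !ffunE !insubdK ?inE ?unfold_in /=; [|exact/phi_lt/HM|exact/phi_lt/HM].
move=> /phi_inj; rewrite !left_cosetM rj -!left_cosetM !inE => /(_ _ _)/(left_coset_eq gN).
have coset_in u : H u -> [set left_coset N v | v in H] (left_coset N u) by exists u.
move=> /(_ (coset_in _ (HM _ _ Hx HmV)) (coset_in _ (HM _ _ Hy HmV))) Nxy.
have mV0 : m^-1 != 0 by rewrite invr_eq0.
have w0 : y^-1 * x != 0 by apply: (div_mulf_neq0 hD); rewrite ?invr_eq0.
split.
  by apply: (div_mulf_neq0 hD) => //; exact: (div_mulf_neq0 hD).
suff -> : to_unit (m * (y^-1 * x) * m^-1)
  = ((to_unit y * to_unit m^-1)^-1 * (to_unit x * to_unit m^-1))%g by [].
rewrite -!to_unitM // -to_unitV ?(div_mulf_neq0 hD) // -to_unitM; last 2 first.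
- by rewrite invr_eq0 (div_mulf_neq0 hD).
- exact: (div_mulf_neq0 hD).
by rewrite div_invMr // invrK !mulrA.
Qed.

End ChainStep.
End UnitGroupSubgroups.

Theorem theorem3p3 (D : unitRingType) (hD : division_ring D)
    (N : set (unit_group D)) (hN : almost_subnormal N) (hNc : ~ central N) :
  exists M : set (unit_group D), [/\ subnormal M, M `<=` N & ~ central M].
Proof.
have [r [C [C0 Cr Csub Cstep]]] := hN.
have CS i j : (i <= j)%N -> (j <= r)%N -> C j `<=` C i.
  move=> /subnK <-; elim: (j - i)%N => [|k IH] kr u Ck; first by rewrite add0n in Ck.
  exact: (IH (ltnW kr) u (proj1 (Cstep _ kr) u Ck)).
have [a [Na nZa]] : exists a, unit_values N a /\ ~ ring_center a.
  apply: contrapT => nex; apply: hNc => _ [u Nu <-].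
  apply: contrapT => nZu; apply: nex; exists (val u); split=> //.
  by split; [exact: unit_neq0|rewrite val_unitK].
have Ca i : (i <= r)%N -> unit_values (C i) a.
  by move=> ir; case: Na => a0 Na; split=> //; apply: (CS i r ir) => //; rewrite Cr.
have [n [M [sM MC MZ]]] : exists n M, [/\ subnormal_depth n M,
    M `<=` unit_values (C r) & ~ M `<=` @ring_center D].
  have : (r <= r)%N by [].
  elim: {1 3}r => [_|i IH ir].
    exists 0%N, [set x : D | x != 0]; split=> // [x x0|MZ].
      by split=> //; rewrite C0.
    by apply: nZa; apply: MZ; case: Na.
  have [n [M [sM MC MZ]]] := IH (ltnW ir).
  have [Cle [nC|fC]] := Cstep i ir.
    have [M' HM'] := chain_step_normal hD sM MZ MC (Csub _ (ltnW ir)) (Csub _ ir) nC (Ca _ ir) nZa.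
    by exists n.+1, M'.
  have [M' HM'] := chain_step_finite_index hD sM MZ MC (Csub _ (ltnW ir)) (Csub _ ir) fC.
  by exists n.+1, M'.
exists (units_in M); split; first exact: (subnormal_units_in hD sM).
  by move=> u /MC[_]; rewrite val_unitK // Cr.
move=> cM; apply: MZ => x Mx; have [x0 _] := MC x Mx.
by apply: cM; exists (to_unit x); rewrite /units_in /= ?to_unitK.
Qed.
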